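(* Let $\Bbbk$ be the base field. The group $\mathbb{X}(\mathrm{C})$ of characters of the Hopf monoid $\mathrm{C}$ of sets of cycles and paths (under convolution) is isomorphic to the group $G$ of pairs of formal power series $\big(g(x),h(x)\big)$ with coefficients in $\Bbbk$ of the form $$g(x)=x+a_1x^2+a_2x^3+\cdots,\qquad h(x)=c_1x+c_2x^2+c_3x^3+\cdots,$$ with product $(g_1,h_1)\cdot(g_2,h_2)=\big(g_1\circ g_2,\ h_1\circ g_2+h_2\big)$.
   Context: A (set) species $\mathrm{P}$ assigns to each finite set $I$ a set $\mathrm{P}[I]$ and to each bijection $\sigma:I\to J$ a map $\mathrm{P}[\sigma]$, functorially; structures $x\in\mathrm{P}[I]$, $y\in \mathrm{P}[J]$ are isomorphic if $y=\mathrm{P}[\sigma](x)$ for a bijection $\sigma$. The species $\mathrm{C}$: $\mathrm{C}[I]$ is the set of (not necessarily simple) graphs with vertex set $I$ each of whose connected components is a path or a cycle, where a cycle on $m$ vertices has exactly $m$ edges (so the cycle on 1 vertex is a single vertex with a loop, and the cycle on 2 vertices is two vertices joined by a double edge). $\mathrm{C}[\emptyset]$ consists of the empty graph $\epsilon$. Hopf monoid structure: for $I=S\sqcup T$, the product of $g_1\in\mathrm{C}[S]$, $g_2\in\mathrm{C}[T]$ is the disjoint union $g_1\sqcup g_2$; the coproduct sends $g\in\mathrm{C}[I]$ to $(g|_S, g/_S)$, where $g/_S=g:T$ is the induced subgraph on $T$, and $g|_S$ is the graph on vertex set $S$ having one edge joining $u,v\in S$ for each $T$-thread from $u$ to $v$,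 i.e. each walk along a path of $g$ (considered up to reversal) from $u$ to $v$ all of whose intermediate vertices (if any) lie in $T$; here $u=v$ is allowed (a cycle of $g$ meeting $S$ only in $u$ gives a loop at $u$), and distinct threads give distinct edges. A character $\zeta$ of $\mathrm{C}$ is a collection of linear maps $\zeta_I:\Bbbk\mathrm{C}[I]\to\Bbbk$ with $\zeta_\emptyset(\epsilon)=1$, $\zeta_I(x\sqcup y)=\zeta_S(x)\zeta_T(y)$ for $I=S\sqcup T$, $x\in\mathrm{C}[S]$, $y\in\mathrm{C}[T]$, and $\zeta_I(x)=\zeta_J(y)$ whenever $x,y$ are isomorphic. Characters form a group under convolution $(\zeta*\xi)_I(x)=\sum_{I=S\sqcup T}\zeta_S(x|_S)\xi_T(x/_S)$.
   Formalization: The base field is assumed to have characteristic 0; over F_p the claim fails, since the values of characters on cycles of length p^i give infinitely many independent homomorphisms from X(C) to F_p, while G has only finitely many. *)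

(* Defs.v *)
From mathcomp Require Import all_boot all_algebra.

Set Implicit Arguments.
Unset Strict Implicit.
Unset Printing Implicit Defensive.

Import GRing.Theory.

(* [g A] is the number of edges of [g] with set of endpoints [A], so
   [g [set u; v]] counts the edges between u and v, and [g [set u]] the loops
   at u. *)
Record mgraph (I : finType) := MGraph {
  mult :> {ffun {set I} -> nat};
  mult_card : forall A, 0 < mult A -> 0 < #|A| <= 2 }.

Definition adjacent (I : finType) (g : mgraph I) : rel I :=
  [rel u v | 0 < g [set u; v]].

Definition component (I : finType) (g : mgraph I) (u : I) : {set I} :=
  [set v | connect (adjacent g) u v].

Definition path_edges (I : finType) (s : seq I) : seq {set I} :=
  [seq [set e.1; e.2] | e <- zip s (behead s)].

Definition cycle_edges (I : finType) (s : seq I) : seq {set I} :=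
  [seq [set e.1; e.2] | e <- zip s (rot 1 s)].

Definition path_on (I : finType) (g : mgraph I) (X : {set I}) : Prop :=
  exists s : seq I, [/\ uniq s, s =i X
    & forall A : {set I}, A \subset X -> g A = count_mem A (path_edges s)].

Definition cycle_on (I : finType) (g : mgraph I) (X : {set I}) : Prop :=
  exists s : seq I, [/\ uniq s, s =i X
    & forall A : {set I}, A \subset X -> g A = count_mem A (cycle_edges s)].

Definition paths_and_cycles (I : finType) (g : mgraph I) : Prop :=
  forall u : I, path_on g (component g u) \/ cycle_on g (component g u).

Record C (I : finType) := MkC {
  graph :> mgraph I;
  graphP : paths_and_cycles graph }.

Definition sub (I : finType) (S : {set I}) : finType := {u : I | u \in S}.

Definition edge (I : finType) (g : mgraph I) : finType :=
  {A : {set I} & 'I_(g A)}.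

(* A walk is recorded by the sequence of edges that it traverses; [ts] is the
   sequence of its intermediate vertices. *)
Definition is_thread (I : finType) (g : mgraph I) (S : {set I})
    (A : {set sub S}) (t : seq (edge g)) : bool :=
  uniq t && [exists u : sub S, [exists v : sub S, [exists ts : #|I|.-bseq I,
    [&& A == [set u; v], uniq ts, all [predC S] ts
      & map tag t == path_edges (val u :: rcons ts (val v))]]]].

(* The threads with set of endpoints [A], each being identified with its
   reversal. *)
Definition threads (I : finType) (g : mgraph I) (S : {set I})
    (A : {set sub S}) : {set {set #|edge g|.-bseq (edge g)}} :=
  [set [set t; [bseq of rev t]] | t : #|edge g|.-bseq (edge g)
                                & is_thread A t].

(* The graphs restricted to a subset, induced on a subset, and the disjoint
   unions are again unions of paths and cycles: see [restrict_pc],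
   [induced_pc] and [union_pc]. *)
Section Strand.
Variable I : finType.
Implicit Types (g : mgraph I) (s : seq I) (A : {set I}) (L : seq {set I}).

Lemma path_edges_cons2 x y s :
  path_edges (x :: y :: s) = [set x; y] :: path_edges (y :: s).
Proof. by []. Qed.

Lemma cycle_edges_cons x s : cycle_edges (x :: s) = path_edges (x :: rcons s x).
Proof.
have zc (p q r : seq I) : size r <= size p -> zip (p ++ q) r = zip p r.
  elim: p r => [|y p IHp] [|z r] //=; first by case: q.
  by rewrite ltnS => /IHp ->.
rewrite /cycle_edges rot1_cons -(zc _ [:: x]) ?size_rcons //.
by rewrite /path_edges cats1.
Qed.

Lemma path_edges_cat s x r :
  path_edges (s ++ x :: r) = path_edges (rcons s x) ++ path_edges (x :: r).
Proof.
elim: s => [|y [|z s] IHs] //.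
by rewrite cat_cons rcons_cons /= in IHs *; rewrite !path_edges_cons2 IHs.
Qed.

Lemma path_edges_rev s : path_edges (rev s) = rev (path_edges s).
Proof.
elim: s => [|x [|y s] IHs] //.
rewrite path_edges_cons2 rev_cons rev_cons -cats1 -cats1 -catA /=.
rewrite path_edges_cat -rev_cons IHs rev_cons -cats1 /=.
by rewrite /path_edges /= setUC.
Qed.

Lemma path_edges_mem s A x : A \in path_edges s -> x \in A -> x \in s.
Proof.
elim: s => [|y [|z s] IHs] //; rewrite path_edges_cons2 inE => /orP[/eqP->|].
  by rewrite !inE => /orP[]/eqP->; rewrite eqxx ?orbT.
by move=> AL xA; rewrite inE IHs ?orbT.
Qed.

Lemma perm_cycle_edges_rot n s :
  perm_eq (cycle_edges (rot n s)) (cycle_edges s).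
Proof.
have rz (r r' : seq I) : size r = size r' ->
    zip (rot n r) (rot n r') = rot n (zip r r').
  move=> sz; rewrite /rot zip_cat ?size_drop ?sz //; congr cat.
    by elim: n r r' sz => [|m IH] [|? ?] [|? ?] //= [/IH].
  by elim: n r r' sz => [|m IH] [|? ?] [|? ?] //= [/IH->].
rewrite /cycle_edges rot_rot rz ?size_rot // perm_map //.
by rewrite perm_rot.
Qed.

Lemma cycle_edges_mem s A x : A \in cycle_edges s -> x \in A -> x \in s.
Proof.
case: s => // y s; rewrite cycle_edges_cons => AL /(path_edges_mem AL).
by rewrite !inE mem_rcons inE; case: eqP.
Qed.

Definition strand_edges s L := L = path_edges s \/ L = cycle_edges s.

Lemma strand_edges_mem s L A x :
  strand_edges s L -> A \in L -> x \in A -> x \in s.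
Proof. by case=> ->; [apply: path_edges_mem | apply: cycle_edges_mem]. Qed.

Definition local g s L :=
  forall A x, x \in A -> x \in s -> g A = count_mem A L.

Definition strand g s L := [/\ uniq s, strand_edges s L & local g s L].

Lemma adjacent_sym g : symmetric (adjacent g).
Proof. by move=> u v; rewrite /adjacent /= setUC. Qed.

Lemma connect_adjC g : connect_sym (adjacent g).
Proof. by apply: sym_connect_sym; exact: adjacent_sym. Qed.

Lemma mult2 g A x : 0 < g A -> x \in A -> exists y, A = [set x; y].
Proof.
move=> /mult_card /andP[_ A2] xA; case: (set_0Vmem (A :\ x)) => [A0|[y yA]].
  by exists x; apply/setP=> z; have /setP/(_ z) := A0; rewrite !inE;
    case: eqP => [->|_]; rewrite ?xA //= => ->.
exists y; apply/esym/eqP; rewrite eqEcard (leq_trans A2) ?andbT.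
  by apply/subsetP=> z; rewrite !inE => /orP[]/eqP->//; move: yA; rewrite !inE => /andP[].
by move: yA; rewrite cards2 !inE eq_sym => /andP[->].
Qed.

Lemma strand_component g s L u :
  strand g s L -> u \in s -> s =i component g u.
Proof.
case=> us sL gL us_ v; rewrite inE.
have adjs x y : x \in s -> adjacent g x y -> y \in s.
  move=> xs; rewrite /adjacent /= (gL _ x) ?inE ?eqxx // -has_count has_pred1.
  by move=> AL; apply: strand_edges_mem sL AL _; rewrite !inE eqxx orbT.
apply/idP/idP=> [vs|/connectP[p pp ->]]; last first.
  elim: p u us_ pp => //= y p IHp u us_ /andP[uy]; apply: IHp.
  exact: adjs uy.
have: {subset path_edges s <= L}.
  case: sL => -> // A; case: (s) => // y s'; rewrite cycle_edges_cons.
  rewrite -rcons_cons; case/lastP: (y :: s') => // r z.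
  have -> : rcons (rcons r z) y = r ++ [:: z; y] by rewrite -!cats1 -catA.
  by rewrite path_edges_cat mem_cat => ->.
have ps A x : A \in L -> x \in A -> 0 < g A.
  move=> AL xA; rewrite (gL _ x) // -?has_count ?has_pred1 //.
  exact: strand_edges_mem AL xA.
case: (s) us_ vs => // x r ux vx sub.
have: path (adjacent g) x r.
  elim: r x sub {ux vx} => //= y r IHr x sub; rewrite IHr ?andbT; last first.
    by move=> A Ar; apply: sub; rewrite path_edges_cons2 inE Ar orbT.
  by apply: (ps _ x); rewrite ?sub ?path_edges_cons2 ?inE ?eqxx.
move=> pr; have con w : w \in x :: r -> connect (adjacent g) x w.
  rewrite inE => /predU1P[->//|wr]; case/splitPr: wr pr => r1 r2.
  rewrite cat_path /= => /and3P[pr1 lw _].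
  by apply/connectP; exists (rcons r1 w); rewrite ?last_rcons // rcons_path pr1.
by rewrite connect_adjC (connect_trans _ (con _ ux)) // connect_adjC con.
Qed.

Lemma paths_and_cyclesP g :
  paths_and_cycles g <->
  forall u, exists s L, strand g s L /\ u \in s.
Proof.
split=> gP u.
- have ex s L : uniq s -> s =i component g u -> strand_edges s L ->
     (forall A, A \subset component g u -> g A = count_mem A L) ->
     exists s L, strand g s L /\ u \in s.
    move=> us sE sL gL; exists s, L; split; last by rewrite sE inE.
    split=> // A x xA xs; have [/gL//|] := boolP (A \subset component g u).
    case/subsetPn=> y yA yC; apply/eqP.
    rewrite (count_memPn _); last first.
      by apply: contra yC => AL; rewrite -sE; apply: strand_edges_mem sL AL yA.
    apply: contraR yC; rewrite -lt0n => gA; have [z Az] := mult2 gA xA.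
    move: yA; rewrite Az !inE => /orP[/eqP->|/eqP->]; first by move: xs; rewrite sE inE.
    move: xs; rewrite sE inE => ux; apply: connect_trans ux (connect1 _).
    by rewrite /adjacent /= -Az.
  by case: (gP u) => -[s [us sE gL]]; apply: (ex s _ us sE _ gL); [left|right].
- case: (gP u) => s [L [gs us]]; have sE := strand_component gs us.
  case: gs => uniqs [] -> gL; [left|right]; exists s; split=> // A sA.
  + case: (set_0Vmem A) => [A0|[x xA]]; last first.
      by apply: (gL _ x) => //; rewrite sE (subsetP sA).
    have ->: g A = 0.
      by apply/eqP; rewrite -leqn0 leqNgt; apply/negP=> /mult_card; rewrite A0 cards0.
    apply/esym/count_memPn; apply/negP; rewrite A0.
    by case/mapP=> -[x y] _ /setP/(_ x); rewrite !inE eqxx.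
  + case: (set_0Vmem A) => [A0|[x xA]]; last first.
      by apply: (gL _ x) => //; rewrite sE (subsetP sA).
    have ->: g A = 0.
      by apply/eqP; rewrite -leqn0 leqNgt; apply/negP=> /mult_card; rewrite A0 cards0.
    apply/esym/count_memPn; apply/negP; rewrite A0.
    by case/mapP=> -[x y] _ /setP/(_ x); rewrite !inE eqxx.
Qed.

End Strand.

Section Threads.
Variable I : finType.
Implicit Types (g : mgraph I) (s : seq I) (S : {set I}).

Lemma edge_enum g (L : seq {set I}) :
  (forall A, A \in L -> count_mem A L <= g A) ->
  exists E : seq (edge g), [/\ uniq E, map tag E = L
    & forall e : edge g, (e \in E) = (tagged e < count_mem (tag e) L)].
Proof.
elim: L => [|A L IHL] gL; first by exists [::].
have [|E [uE tE memE]] := IHL.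
  by move=> B BL; apply: leq_trans (gL B _); rewrite /= ?leq_addl ?inE ?BL ?orbT.
have lt : count_mem A L < g A.
  by apply: leq_trans (gL A _); rewrite /= ?inE eqxx.
pose e0 : edge g := Tagged (fun A => 'I_(g A)) (Ordinal lt).
exists (e0 :: E); split=> [||e] /=; last 1 first.
- case: e => B k; rewrite inE memE /=; case: (eqVneq A B) => [AB|nAB].
    subst B; rewrite /= add1n ltnS [RHS]leq_eqVlt; congr orb.
    by rewrite -tag_eqE /tag_eq /= eqxx tagged_asE -val_eqE.
  by rewrite add0n -tag_eqE /tag_eq /= eq_sym (negPf nAB).
- by rewrite uE memE /= ltnn.
- by rewrite tE.
Qed.

Lemma path_edges_split (p : seq I) L1 A L2 :
  path_edges p = L1 ++ A :: L2 -> exists p1 x y p2,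
    [/\ p = p1 ++ x :: y :: p2, A = [set x; y],
        L1 = path_edges (rcons p1 x) & L2 = path_edges (y :: p2)].
Proof.
elim: p L1 => [|x [|y p] IHp] [|A1 L1] //.
  by rewrite path_edges_cons2 => -[<- <-]; exists [::], x, y, p.
rewrite path_edges_cons2 => -[<- /IHp[p1 [x' [y' [p2 [pE -> L1E L2E]]]]]].
exists (x :: p1), x', y', p2; split=> //; first by rewrite pE.
by rewrite L1E; case: (p1) pE => [|? ?] [-> _].
Qed.

Section Det.
Variables (E : eqType) (tg : E -> {set I}).

Lemma thread_det B a b F t ts v :
    a \notin B -> uniq B -> b \notin B -> v \notin B ->
    {subset ts <= B} -> uniq ts -> uniq t -> {subset t <= F} ->
    map tg F = path_edges (a :: rcons B b) ->
    map tg t = path_edges (a :: rcons ts v) ->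
    (forall x0, head x0 t = head x0 F) -> t = F.
Proof.
elim: B a F t ts => [|b1 B IHB] a F t ts.
  move=> _ _ _ _ ts0 _ ut tF.
  case: ts ts0 => [_|x ts /(_ x)]; last by rewrite inE eqxx => /(_ isT).
  case: F tF => [|e [|? ?]] //= tF _; case: t tF ut => [|e' [|? ?]] //= tF _ _ /(_ e').
  by move->.
rewrite /= inE negb_or => /andP[ab1 aB] /andP[b1B uB].
rewrite inE negb_or => /andP[bb1 bB]; rewrite inE negb_or => /andP[vb1 vB].
move=> tsB uts ut tF; rewrite path_edges_cons2.
case: F tF => [|e0 F] // tF [te0 tgF].
case: ts tsB uts => [|w ts] tsB uts.
  case: t tF ut => [|e [|? ?]] //= tF _ [te] /(_ e)/= Ee.
  move: te0; rewrite -Ee te => /setP/(_ b1); rewrite !inE eqxx orbT.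
  by rewrite eq_sym (negPf ab1) eq_sym (negPf vb1).
rewrite rcons_cons path_edges_cons2.
case: t tF ut => [|e t] // tF /andP[et ut] [te tgt] /(_ e)/= Ee; subst e.
have Ew : w = b1.
  move: te0; rewrite te => /setP/(_ b1); rewrite !inE eqxx orbT.
  by rewrite eq_sym (negPf ab1) /= => /eqP.
subst w; move: uts => /= /andP[b1ts uts].
have tF' : {subset t <= F}.
  by move=> x xt; have := tF x; rewrite !inE xt orbT => /(_ isT)/predU1P[xe|//];
    rewrite -xe xt in et.
congr cons; apply: (IHB b1 _ _ ts) => //.
  move=> x xts; have := tsB x; rewrite !inE xts orbT => /(_ isT)/predU1P[xe|//].
  by rewrite -xe xts in b1ts.
move=> x0; have [e [t' Et]] : exists e t', t = e :: t'.
  by case: (t) tgt => [|e t']; [case: (ts) | exists e, t'].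
have b1e : b1 \in tg e.
  move: tgt; rewrite Et; case: (ts) => [|? ?] /= [-> _]; exact: set21.
have: e \in F by rewrite tF' // Et mem_head.
rewrite Et /=; case: F tgF {tF tF'} => [|f F] //=.
rewrite inE; case: B {IHB} b1B bB {uB aB vB tsB} => [|b2 B] /= b1B bB.
  by case: F => [|//] _; rewrite orbF => /eqP.
rewrite path_edges_cons2 => -[_ tgF] /predU1P[//|eF].
have := path_edges_mem (_ : tg e \in path_edges (b2 :: rcons B b)) b1e.
rewrite -tgF map_f // => /(_ isT); rewrite inE mem_rcons inE.
move: b1B; rewrite inE negb_or => /andP[/negPf-> /negPf->].
by rewrite eq_sym (negPf bb1).
Qed.

Lemma thread_seg B a b F t ts u v :
    a \notin B -> uniq B -> b \notin B -> u \notin B -> v \notin B ->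
    {subset ts <= B} -> uniq ts -> uniq t -> uniq F -> {subset t <= F} ->
    map tg F = path_edges (a :: rcons B b) ->
    map tg t = path_edges (u :: rcons ts v) ->
  t = F \/ t = rev F.
Proof.
move=> aB uB bB uB' vB tsB uts ut uF tF tgF tgt.
have [e [t' Et]] : exists e t', t = e :: t'.
  by case: (t) tgt => [|e t']; [case: (ts) | exists e, t'].
have ue : u \in tg e.
  move: tgt; rewrite Et; case: (ts) => [|? ?] /= [-> _]; exact: set21.
have eF : e \in F by rewrite tF // Et mem_head.
have start (a' b' : I) (B' : seq I) (F' : seq E) : a' \notin B' -> {subset B' <= B} ->
    u \notin B' ->
    map tg F' = path_edges (a' :: rcons B' b') -> (exists F2, F' = e :: F2) ->
    0 < size B' -> u = a'.
  case: B' => // b1 B' aB' sB uB1 tg' [F2 F'E] _; move: tg'; rewrite F'E /=.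
  rewrite path_edges_cons2 => -[te _]; move: ue; rewrite te !inE => /orP[/eqP//|].
  by move: uB1; rewrite inE negb_or => /andP[/negPf->].
case: (posnP (size B)) => [/size0nil B0|B_gt0].
  left; rewrite B0 in tgF tsB; case: F tgF tF {uF eF} => [|f [|? ?]] // _ tF.
  move: ut tF; rewrite Et; case: (t') => [|e' t2] /=.
    by move=> _ /(_ e); rewrite mem_head inE => /(_ isT)/eqP->.
  move=> /andP[ee _] tF; have := tF e; have := tF e'.
  rewrite !inE !eqxx orbT /= => /(_ isT)/eqP e1 /(_ isT)/eqP e2.
  by rewrite e1 e2 inE eqxx in ee.
have: (exists F2, F = e :: F2) \/ (exists F2, rev F = e :: F2).
  case/splitPr: eF tgF {uF tF} => F1 F2; rewrite map_cat /=.
  case/esym/path_edges_split=> [p1 [x [y [p2 [pE eE F1E F2E]]]]].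
  case: p1 pE F1E => [|a1 p1] pE F1E.
    by left; exists F2; case: F1 F1E.
  case/lastP: p2 pE F2E => [|p2 b2] pE F2E.
    right; exists (rev F1); rewrite -cat1s catA rev_cat.
    by case: F2 F2E => //; rewrite cats1 rev_rcons.
  case: pE => _; rewrite -!rcons_cons -rcons_cat => /rcons_inj[BE _].
  move: ue uB'; rewrite eE BE !inE mem_cat !inE => /orP[]->; by rewrite ?orbT.
have tgF' : map tg (rev F) = path_edges (b :: rcons (rev B) a).
  by rewrite map_rev tgF -path_edges_rev rev_cons rev_rcons.
case=> F2E; [left|right].
  have ua : u = a by apply: (start a b B F).
  apply: (thread_det aB uB bB vB tsB uts ut tF tgF); first by rewrite -ua.
  by case: F2E => F2 ->; rewrite Et.
have ub : u = b.
  apply: (start b a (rev B) (rev F)) => //; rewrite ?mem_rev ?size_rev // => x.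
  by rewrite mem_rev.
have tsB' : {subset ts <= rev B} by move=> x; rewrite mem_rev; apply: tsB.
have tF' : {subset t <= rev F} by move=> x; rewrite mem_rev; apply: tF.
rewrite ub in tgt; apply: (thread_det _ _ _ _ tsB' uts ut tF' tgF' tgt);
  rewrite ?mem_rev ?rev_uniq //.
by case: F2E => F2 ->; rewrite Et.
Qed.
End Det.

Section Blocks.
Variables (E : eqType) (tg : E -> {set I}) (S : {set I}).

Definition good_block (k : (I * I) * (seq I * seq E)) :=
  [/\ k.1.1 \in S, k.1.2 \in S, all [predC S] k.2.1
    & map tg k.2.2 = path_edges (k.1.1 :: rcons k.2.1 k.1.2)].

Lemma blocksP s a (Es : seq E) : a \in S -> map tg Es = path_edges (a :: s) ->
  exists (ks : seq ((I * I) * (seq I * seq E))) c post Epost,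
  [/\ forall k, k \in ks -> good_block k,
      Es = flatten [seq k.2.2 | k <- ks] ++ Epost,
      [seq [set k.1.1; k.1.2] | k <- ks] = path_edges (a :: filter (mem S) s),
      s = flatten [seq rcons k.2.1 k.1.2 | k <- ks] ++ post
    & [/\ c \in S, all [predC S] post & map tg Epost = path_edges (c :: post)]].
Proof.
have [n] := ubnP (size s); elim: n s a Es => // n IHn s a Es sn aS tE.
have [hS|nS] := boolP (has (mem S) s); last first.
  exists [::], a, s, Es; split=> //=.
    by move: nS; rewrite has_filter negbK => /eqP->.
  by split=> //; rewrite all_predC.
case/split_find: hS sn tE => b B s2 bS nB sn.
rewrite cat_rcons -cat_cons path_edges_cat => tE.
have [E1 [E2 [EE tE1 tE2]]] : exists E1 E2, [/\ Es = E1 ++ E2,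
    map tg E1 = path_edges (rcons (a :: B) b) & map tg E2 = path_edges (b :: s2)].
  exists (take (size (path_edges (rcons (a :: B) b))) Es),
         (drop (size (path_edges (rcons (a :: B) b))) Es).
  by rewrite cat_take_drop map_take map_drop tE take_size_cat ?drop_size_cat.
have [|ks [c [post [Epost [gk E2E eE sE cP]]]]] := IHn s2 b E2 _ bS tE2.
  rewrite size_cat size_rcons addSn ltnS in sn.
  exact: leq_ltn_trans (leq_addl _ _) sn.
exists (((a, b), (B, E1)) :: ks), c, post, Epost; split=> //=.
- move=> k; rewrite inE => /predU1P[->|/gk//]; split=> //=.
  by rewrite all_predC.
- by rewrite EE E2E catA.
- rewrite filter_cat /= (bS : b \in S).
  by move: nB; rewrite has_filter negbK => /eqP->; rewrite path_edges_cons2 eE.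
- by rewrite -catA -sE cat_rcons.
Qed.

Lemma thread_chain (P : pred E) t ts u v :
    map tg t = path_edges (u :: rcons ts v) ->
    (forall e e' x, x \in ts -> x \in tg e -> x \in tg e' -> P e -> P e') ->
  has P t -> all P t.
Proof.
elim: ts t u => [|w ts IHts] t u.
  by case: t => [|e [|? ?]] //= _ _; rewrite orbF andbT.
rewrite rcons_cons path_edges_cons2; case: t => // e t [te tt] PP.
have we : w \in tg e by rewrite te set22.
have IH : has P t -> all P t.
  by apply: IHts tt _ => e1 e2 x xts; apply: PP; rewrite inE xts orbT.
case: t IH tt => [|e' t] IH; first by case: (ts).
move=> tt; have we' : w \in tg e'.
  by move: tt; case: (ts) => [|? ?] [-> _]; rewrite set21.
have Pe : P e = P e'.
  by apply/idP/idP; apply: (PP _ _ w); rewrite ?mem_head.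
by move: IH; rewrite /= Pe orbA orbb andbA andbb.
Qed.

Lemma path_edges_cover (s : seq I) x : 1 < size s -> x \in s ->
  exists2 A, A \in path_edges s & x \in A.
Proof.
elim: s => [|y [|z s] IHs] // _; rewrite path_edges_cons2.
rewrite inE => /predU1P[->|xs].
  by exists [set y; z]; rewrite ?mem_head ?set21.
case: s IHs xs => [|w s] IHs xs.
  exists [set y; z]; rewrite ?mem_head //.
  by move: xs; rewrite inE => /eqP->; rewrite set22.
by have [//|//|A As xA] := IHs; exists A; rewrite // inE As orbT.
Qed.

Lemma thread_ends u v ts x : all [predC S] ts -> u \in S -> v \in S -> x \in S ->
  (x \in [set u; v]) = has (fun A : {set I} => x \in A) (path_edges (u :: rcons ts v)).
Proof.
move=> nts uS vS xS; apply/idP/hasP => [xuv|[A As /(path_edges_mem As)]].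
  have [||A] := @path_edges_cover (u :: rcons ts v) x; last by exists A.
    by rewrite /= size_rcons.
  by move: xuv; rewrite !inE mem_rcons inE => /orP[]->; rewrite ?orbT.
rewrite !inE mem_rcons inE => /or3P[-> //|->|/(allP nts)/=]; rewrite ?orbT //.
by rewrite xS.
Qed.

Lemma thread_dead_end c D F t ts u v :
    c \in S -> u \in S -> v \in S -> all [predC S] D -> all [predC S] ts ->
    uniq t -> {subset t <= F} -> map tg F = path_edges (c :: D) ->
    map tg t = path_edges (u :: rcons ts v) ->
  False.
Proof.
move=> cS uS vS nD nts ut tF tgF tgt.
have onlyc e x : e \in F -> x \in S -> x \in tg e -> x = c.
  move=> eF xS xe; have := path_edges_mem (_ : tg e \in path_edges (c :: D)) xe.
  rewrite -tgF map_f // inE => /(_ isT)/predU1P[//|/(allP nD)/=].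
  by rewrite xS.
have [e [t' Et]] : exists e t', t = e :: t'.
  by case: (t) tgt => [|e t']; [case: (ts) | exists e, t'].
have ue : u \in tg e.
  by move: tgt; rewrite Et; case: (ts) => [|? ?] /= [-> _]; exact: set21.
have uc : u = c by apply: onlyc ue => //; rewrite tF // Et mem_head.
have [e' [t2 Et2]] : exists e t', t = rcons t' e.
  by rewrite Et lastI; exists (last e t'), (belast e t').
have ve' : v \in tg e'.
  move: tgt; rewrite Et2 map_rcons => /(congr1 rev).
  by rewrite rev_rcons -path_edges_rev rev_cons rev_rcons;
    case: (rev ts) => [|? ?] /= [-> _]; exact: set21.
have vc : v = c by apply: onlyc ve' => //; rewrite tF // Et2 mem_rcons mem_head.
have cD : c \notin D by apply/negP=> /(allP nD)/=; rewrite cS.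
have ee' : e = e'.
  have uni f : f \in F -> c \in tg f -> exists F2, F = f :: F2.
    case: F tgF {tF onlyc} => // f' F; case: D {nD} cD => // d D cD.
    rewrite path_edges_cons2 => -[_ tgF]; rewrite inE => /predU1P[->|fF cf].
      by exists F.
    have := path_edges_mem (_ : tg f \in path_edges (d :: D)) cf.
    by rewrite -tgF map_f // => /(_ isT); rewrite (negPf cD).
  have [||F2] := uni e; rewrite -?uc ?tF ?Et ?mem_head //.
  have [||F3 ->] := uni e'; rewrite -?vc ?tF ?Et2 ?mem_rcons ?mem_head //.
  by case.
case: ts nts tgt => [|w ts] nts tgt; last first.
  move: ut Et2 tgt; rewrite Et ee' => /andP[e't' _].
  case/lastP: t' e't' {Et} => [|t' f] e't'; first by case: (ts).
  by rewrite -rcons_cons => /rcons_inj[_ fe]; rewrite -fe mem_rcons mem_head in e't'.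
move: tgt; rewrite Et => -[te _].
have eF : e \in F by rewrite tF // Et mem_head.
case: D nD cD tgF => [|d D] nD cD tgF; first by case: (F) tgF eF.
have [F2 FE] : exists F2, F = e :: F2; last first.
  move: tgF; rewrite FE path_edges_cons2 => -[te2 _].
  move: te; rewrite te2 uc vc => /setP/(_ d); rewrite !inE eqxx orbT => /esym.
  by rewrite orbb => /eqP dc; rewrite -dc mem_head in cD.
case: F tgF eF {tF onlyc} => // f' F.
rewrite path_edges_cons2 => -[_ tgF]; rewrite inE => /predU1P[->|fF].
  by exists F.
have := path_edges_mem (_ : tg e \in path_edges (d :: D)) ue.
by rewrite -tgF map_f // => /(_ isT); rewrite uc (negPf cD).
Qed.

End Blocks.

Section Count.
Variables (g : mgraph I) (S : {set I}).
Implicit Types (A : {set sub S}) (t : seq (edge g)).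

Lemma is_threadP A t :
  reflect (exists u v ts, [/\ A = [set u; v], uniq t, uniq ts, all [predC S] ts
      & map tag t = path_edges (val u :: rcons ts (val v))])
    (is_thread A t).
Proof.
apply: (iffP andP) => [[ut /existsP[u /existsP[v /existsP[ts]]]]|].
  by case/and4P=> /eqP-> uts nts /eqP tgt; exists u, v, ts.
case=> u [v [ts [-> ut uts nts tgt]]]; split=> //.
apply/existsP; exists u; apply/existsP; exists v.
have sts : size ts <= #|I| by rewrite -(card_uniqP uts) max_card.
by apply/existsP; exists (Bseq sts); rewrite eqxx /= uts nts tgt eqxx.
Qed.

Lemma is_thread_rev A t : is_thread A t -> is_thread A (rev t).
Proof.
case/is_threadP=> u [v [ts [-> ut uts nts tgt]]]; apply/is_threadP.
exists v, u, (rev ts); rewrite setUC rev_uniq rev_uniq all_rev map_rev tgt.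
by split=> //; rewrite -path_edges_rev rev_cons rev_rcons.
Qed.

Definition cls t : {set #|edge g|.-bseq (edge g)} :=
  [set insub_bseq _ t; insub_bseq _ (rev t)].

Lemma val_insub_bseq t : uniq t -> insub_bseq #|edge g| t = t :> seq _.
Proof. by move=> ut; rewrite /insub_bseq insubdK // unfold_in -(card_uniqP ut) max_card. Qed.

Lemma uniq_cls (Fs : seq (seq (edge g))) :
  uniq (flatten Fs) -> all (fun F => 0 < size F) Fs -> uniq (map cls Fs).
Proof.
elim: Fs => //= F Fs IH; rewrite cat_uniq => /and3P[uF FFs uFs] /andP[F0 nFs].
rewrite IH // andbT; apply/negP=> /mapP[F' F'Fs].
have uF' : uniq F'.
  by case/splitPr: F'Fs uFs => F1 F2; rewrite flatten_cat cat_uniq /= cat_uniq =>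
    /and3P[_ _ /and3P[]].
move/setP/(_ (insub_bseq _ F)); rewrite !inE eqxx /= => /esym.
have FF' : F =i F' -> False.
  case: F F0 {uF} FFs => // e F _ FFs /(_ e); rewrite mem_head => /esym eF'.
  by case/hasP: FFs; exists e; [apply/flattenP; exists F' | rewrite mem_head].
case/orP=> /eqP/(congr1 val)/=; rewrite !val_insub_bseq ?rev_uniq // => E;
  by apply: FF' => x; rewrite E ?mem_rev.
Qed.

Lemma count_threads (Es : seq (edge g)) pre a q A :
    uniq Es -> map tag Es = path_edges (pre ++ a :: q) ->
    a \in S -> all [predC S] pre ->
    uniq (filter [predC S] (pre ++ a :: q)) ->
    (forall (e : edge g) x, x \in tag e -> x \in pre ++ a :: q -> e \in Es) ->
    (exists2 u, u \in A & val u \in pre ++ a :: q) ->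
  #|threads g A| = count_mem (val @: A) (path_edges (a :: filter (mem S) q)).
Proof.
move=> uE tgE aS npre uT full [w wA wp].
move: (tgE); rewrite path_edges_cat.
set n := size (path_edges (rcons pre a)) => tgE'.
pose Epre := take n Es; pose Emid := drop n Es.
have tpre : map tag Epre = path_edges (rcons pre a).
  by rewrite /Epre map_take tgE' take_size_cat.
have tmid : map tag Emid = path_edges (a :: q).
  by rewrite /Emid map_drop tgE' drop_size_cat.
have EE : Es = Epre ++ Emid by rewrite cat_take_drop.
clearbody Epre Emid; clear tgE' n.
have [ks [c [post [Epost [gk EmE eE qE [cS npost tpost]]]]]] := blocksP aS tmid.
have occ x p1 p2 : x \notin S -> pre ++ a :: q = p1 ++ p2 ->
    x \in p1 -> x \in p2 -> False.
  move=> xS pE xp1 xp2; move: uT; rewrite pE filter_cat cat_uniq => /and3P[_ /hasP[]].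
  by exists x; rewrite mem_filter /= xS.
have inE_ (e : edge g) x : e \in Es -> x \in tag e -> x \in pre ++ a :: q.
  by move=> eEs; apply: path_edges_mem; rewrite -tgE map_f.
have closed k (e : edge g) x : k \in ks -> x \in k.2.1 -> x \in tag e -> e \in k.2.2.
  move=> kks xB xe; have [k1S k2S nB tF] := gk k kks.
  have xS : x \notin S by apply: (allP nB).
  case/splitPr: kks gk EmE eE qE => k1 k2 gk EmE eE qE.
  have pE : pre ++ a :: q = (rcons pre a ++ flatten [seq rcons k.2.1 k.1.2 | k <- k1])
     ++ k.2.1 ++ (k.1.2 :: flatten [seq rcons k.2.1 k.1.2 | k <- k2] ++ post).
    by rewrite qE map_cat flatten_cat /= -!catA !cat_rcons -?catA.
  have outF k' : k' \in k1 ++ k :: k2 -> e \in k'.2.2 -> x \in k'.2.1.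
    move=> /gk[k1S' k2S' _ tF'] ek'.
    have := path_edges_mem (_ : tag e \in path_edges (k'.1.1 :: rcons k'.2.1 k'.1.2)) xe.
    rewrite -tF' map_f // inE mem_rcons inE => /(_ isT)/or3P[/eqP xk|/eqP xk|//].
      by rewrite xk k1S' in xS.
    by rewrite xk k2S' in xS.
  have flat (ks' : seq ((I * I) * (seq I * seq (edge g)))) k' : k' \in ks' -> x \in k'.2.1 ->
      x \in flatten [seq rcons k.2.1 k.1.2 | k <- ks'].
    move=> k'ks xB'; apply/flattenP; exists (rcons k'.2.1 k'.1.2); first by apply: map_f.
    by rewrite mem_rcons inE xB' orbT.
  have : e \in Es by apply: full xe _; rewrite pE !mem_cat xB !orbT.
  rewrite EE EmE map_cat flatten_cat /= !mem_cat => /or3P[||].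
  - move=> ep; exfalso; have := path_edges_mem (_ : tag e \in path_edges (rcons pre a)) xe.
    rewrite -tpre map_f // => /(_ isT) xpre.
    by apply: (occ _ _ _ xS pE); rewrite mem_cat ?xpre ?xB.
  - case/orP=> [/flattenP[F /mapP[k' k'k1 ->] eF]|/orP[//|/flattenP[F /mapP[k' k'k2 ->] eF]]].
      exfalso; apply: (occ _ _ _ xS pE); rewrite mem_cat ?xB ?orbT //.
      by rewrite (flat _ k') ?orbT // outF // mem_cat k'k1.
    exfalso; rewrite catA in pE; apply: (occ _ _ _ xS pE); rewrite ?inE !mem_cat ?xB ?orbT //.
    by rewrite (flat _ k') ?orbT // outF // mem_cat inE k'k2 !orbT.
  - move=> ep; exfalso; have := path_edges_mem (_ : tag e \in path_edges (c :: post)) xe.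
    rewrite -tpost map_f // inE => /(_ isT)/predU1P[xc|xpost].
      by rewrite xc cS in xS.
    rewrite catA in pE; apply: (occ _ _ _ xS pE); rewrite ?inE !mem_cat ?xB ?orbT //.
    by rewrite xpost !orbT.
have uF : uniq (flatten [seq k.2.2 | k <- ks]).
  by move: uE; rewrite EE EmE !cat_uniq => /and3P[_ _ /and3P[]].
have uB k : k \in ks -> uniq k.2.1.
  move=> kks; have [_ _ nB _] := gk k kks; case/splitPr: kks qE => k1 k2 qE.
  move: uT; rewrite qE map_cat flatten_cat /= filter_cat cat_uniq => /and3P[_ _].
  rewrite /= aS /= -catA filter_cat cat_uniq => /and3P[_ _].
  rewrite -catA filter_cat cat_uniq => /andP[+ _].
  rewrite filter_rcons; case: ifP => _; rewrite ?rcons_uniq;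
    by move: nB => /all_filterP->; try case/andP.
have notB k x : k \in ks -> x \in S -> x \notin k.2.1.
  by move=> /gk[_ _ nB _] xS; apply/negP=> /(allP nB); rewrite /= xS.
have val2 (u v : sub S) : val @: [set u; v] = [set val u; val v].
  by rewrite imsetU1 imset_set1.
have thrP t : is_thread A t <->
    exists2 k, k \in ks & val @: A = [set k.1.1; k.1.2] /\ (t = k.2.2 \/ t = rev k.2.2).
  split; last first.
    case=> k kks [AE]; have [k1S k2S nB tF] := gk k kks.
    have ukF : uniq k.2.2.
      case/splitPr: kks uF => k1 k2; rewrite map_cat flatten_cat cat_uniq /= cat_uniq.
      by case/and3P=> _ _ /and3P[].
    have thr : is_thread A k.2.2.
      apply/is_threadP; exists (exist [in S] _ k1S), (exist [in S] _ k2S), k.2.1; split=> //.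
        by apply: (imset_inj val_inj); rewrite val2 AE.
      exact: uB.
    by case=> -> //; apply: is_thread_rev.
  case/is_threadP=> u [v [ts [AE ut uts nts tgt]]].
  have uS := valP u; have vS := valP v.
  have [e [t' Et]] : exists e t', t = e :: t'.
    by case: (t) tgt => [|e t']; [case: (ts) | exists e, t'].
  have tE : {subset t <= Es}.
    apply/allP; apply: (thread_chain (P := mem Es) tgt) => [e1 e2 x xts xe1 xe2 e1E|].
      by apply: full xe2 (inE_ _ _ e1E xe1).
    have := @path_edges_cover (val u :: rcons ts (val v)) (val w).
    rewrite -tgt => -[||B].
    - by rewrite /= size_rcons.
    - move: wA; rewrite AE !inE mem_rcons inE => /orP[]/eqP->; rewrite eqxx ?orbT //.
    by case/mapP=> f ft -> wf; apply/hasP; exists f => //; apply: full wf wp.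
  have eEs : e \in Es by rewrite tE // Et mem_head.
  have sub_dead D d (F : seq (edge g)) : d \in S -> all [predC S] D -> e \in F ->
      map tag F = path_edges (d :: D) ->
      (forall (f : edge g) x, x \in D -> x \in tag f -> f \in Es -> f \in F) -> False.
    move=> dS nD eF tgF clF; apply: (thread_dead_end dS uS vS nD nts ut _ tgF tgt).
    have : all (fun f : edge g => (f \in Es) && (f \in F)) t.
      apply: (thread_chain tgt) => [e1 e2 x xts xe1 xe2 /andP[e1E e1F]|].
        have e2E : e2 \in Es by apply: full xe2 (inE_ _ _ e1E xe1).
        rewrite e2E; apply: clF xe2 e2E.
        have := path_edges_mem (_ : tag e1 \in path_edges (d :: D)) xe1.
        rewrite -tgF map_f // inE => /(_ isT)/predU1P[xd|//].
        by have := allP nts _ xts; rewrite /= xd dS.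
      by rewrite Et /= eEs eF.
    by move=> /allP tF x /tF /andP[].
  move: (eEs); rewrite EE EmE !mem_cat => /or3P[ep|/flattenP[F /mapP[k kks ->] ek]|ep].
  - exfalso; apply: (@sub_dead (rev pre) a (rev Epre)); rewrite ?all_rev ?mem_rev //.
      by rewrite map_rev tpre -path_edges_rev rev_rcons.
    move=> f x; rewrite mem_rev mem_rev => xpre xf.
    have xS : x \notin S by apply: (allP npre).
    rewrite EE mem_cat => /orP[//|fm]; exfalso.
    apply: (occ _ pre (a :: q) xS) => //.
    by apply: path_edges_mem xf; rewrite -tmid map_f.
  - have [k1S k2S nB tF] := gk k kks.
    exists k => //.
    have tsB (e1 : edge g) x : x \in ts -> x \in tag e1 -> e1 \in k.2.2 -> x \in k.2.1.
      move=> xts xe1 e1k.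
      have := path_edges_mem (_ : tag e1 \in path_edges (k.1.1 :: rcons k.2.1 k.1.2)) xe1.
      have xS : x \notin S by apply: (allP nts).
      rewrite -tF map_f // inE mem_rcons inE => /(_ isT)/or3P[/eqP xk|/eqP xk|//].
        by rewrite xk k1S in xS.
      by rewrite xk k2S in xS.
    have tk : {subset t <= k.2.2}.
      apply/allP; apply: (thread_chain tgt) => [e1 e2 x xts xe1 xe2 e1F|].
        by apply: closed xe2 => //; apply: tsB xe1 e1F.
      by rewrite Et /= ek.
    have ukF : uniq k.2.2.
      case/splitPr: (kks) uF => k1 k2; rewrite map_cat flatten_cat cat_uniq /= cat_uniq.
      by case/and3P=> _ _ /and3P[].
    have tsk : {subset ts <= k.2.1}.
      move=> x xts; have [||B] := @path_edges_cover (val u :: rcons ts (val v)) x.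
      + by rewrite /= size_rcons.
      + by rewrite inE mem_rcons inE xts !orbT.
      by rewrite -tgt => /mapP[f ft ->] xf; apply: tsB xf _ => //; apply: tk.
    have tFF : t = k.2.2 \/ t = rev k.2.2.
      by apply: (thread_seg _ _ _ _ _ tsk uts ut ukF tk tF tgt);
        rewrite ?notB ?uB.
    split=> //; rewrite AE val2; apply/setP=> x.
    have [xS|xS] := boolP (x \in S); last first.
      by apply/idP/idP; rewrite !inE => /orP[]/eqP xE; rewrite xE ?uS ?vS ?k1S ?k2S in xS.
    rewrite (thread_ends nts) // (thread_ends nB) // -tF -tgt.
    by case: tFF => ->; rewrite ?map_rev ?has_rev.
  - exfalso; apply: (@sub_dead post c Epost) => // f x xpost xf.
    have xS : x \notin S by apply: (allP npost).
    have pE : pre ++ a :: q =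
       (rcons pre a ++ flatten [seq rcons k.2.1 k.1.2 | k <- ks]) ++ post.
      by rewrite qE -!catA cat_rcons.
    rewrite EE EmE !mem_cat => /or3P[fp|/flattenP[F /mapP[k kks ->] fk]|//]; exfalso.
      apply: (occ _ _ _ xS pE) => //; rewrite mem_cat.
      by rewrite (path_edges_mem _ xf) // -tpre map_f.
    have [k1S k2S nB tF] := gk k kks.
    apply: (occ _ _ _ xS pE) => //; rewrite mem_cat.
    have := path_edges_mem (_ : tag f \in path_edges (k.1.1 :: rcons k.2.1 k.1.2)) xf.
    rewrite -tF map_f // inE => /(_ isT)/predU1P[xk|xk]; first by rewrite xk k1S in xS.
    by apply/orP; right; apply/flattenP; exists (rcons k.2.1 k.1.2) => //; apply/mapP; exists k.
have -> : threads g A =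
    [set x in [seq cls k.2.2 | k <- ks & [set k.1.1; k.1.2] == val @: A]].
  apply/setP=> X; rewrite inE; apply/imsetP/mapP.
  - case=> t; rewrite inE => /thrP[k kks [AE tE]] ->.
    exists k; first by rewrite mem_filter kks AE eqxx.
    have ut : uniq k.2.2.
      case/splitPr: (kks) uF => k1 k2; rewrite map_cat flatten_cat cat_uniq /= cat_uniq.
      by case/and3P=> _ _ /and3P[].
    rewrite /cls; case: tE => tE.
      by congr [set _; _]; apply: val_inj; rewrite /= val_insub_bseq ?rev_uniq // tE.
    rewrite setUC; congr [set _; _]; apply: val_inj;
      by rewrite /= val_insub_bseq ?rev_uniq // tE ?revK.
  - case=> k; rewrite mem_filter => /andP[/eqP AE kks] ->.
    have ut : uniq k.2.2.
      case/splitPr: (kks) uF => k1 k2; rewrite map_cat flatten_cat cat_uniq /= cat_uniq.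
      by case/and3P=> _ _ /and3P[].
    exists (insub_bseq _ k.2.2).
      by rewrite inE val_insub_bseq //; apply/thrP; exists k => //; split; [|left].
    rewrite /cls; congr [set _; _]; apply: val_inj.
    by rewrite /= !val_insub_bseq ?rev_uniq.
rewrite cardsE; set l := map _ _; have /card_uniqP -> : uniq l.
  rewrite /l; apply: (subseq_uniq (map_subseq _ (filter_subseq _ _))).
  rewrite (map_comp cls); apply: uniq_cls => //; apply/allP=> F /mapP[k /gk[_ _ _ tF] ->].
  by rewrite -(size_map tag) tF size_map size_zip /= size_rcons minnE subSnn.
by rewrite /l size_map size_filter -eE count_map.
Qed.

End Count.
End Threads.

Section Closure.
Variable I : finType.
Implicit Types (S : {set I}).

Lemma path_edges_map (J : finType) (f : J -> I) (s : seq J) :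
  path_edges (map f s) = [seq f @: A | A : {set J} <- path_edges s].
Proof.
elim: s => [|x [|y s] IHs] //=.
by rewrite !path_edges_cons2 IHs imsetU1 imset_set1.
Qed.

Lemma cycle_edges_map (J : finType) (f : J -> I) (s : seq J) :
  cycle_edges (map f s) = [seq f @: A | A : {set J} <- cycle_edges s].
Proof.
case: s => // x s; rewrite map_cons !cycle_edges_cons -map_rcons -map_cons.
exact: path_edges_map.
Qed.

Lemma count_mem_imset (J : finType) (f : J -> I) (L : seq {set J}) (A : {set J}) :
  injective f -> count_mem (f @: A) [seq f @: B | B : {set J} <- L] = count_mem A L.
Proof.
move=> fI; rewrite count_map; apply: eq_count => B /=.
by apply/eqP/eqP => [/(imset_inj fI)|->].
Qed.

Lemma lift_seq S (l : seq I) : all (mem S) l ->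
  exists s : seq (sub S), map val s = l.
Proof.
elim: l => [|x l IHl] /=; first by exists [::].
by case/andP=> xS /IHl[s <-]; exists (exist [in S] x xS :: s).
Qed.

Lemma sub_imset S (A : {set sub S}) : val @: A \subset S.
Proof. by apply/subsetP=> x /imsetP[u _ ->]; apply: valP. Qed.

Lemma sub_preimset S (A : {set I}) :
  A \subset S -> val @: (val @^-1: A : {set sub S}) = A.
Proof.
move=> AS; apply/setP=> x; apply/imsetP/idP=> [[u + ->]|xA].
  by rewrite inE.
by exists (exist [in S] x (subsetP AS x xA)); rewrite ?inE.
Qed.

Lemma restrict_card (g : mgraph I) S (A : {set sub S}) :
  0 < [ffun B : {set sub S} => #|threads g B|] A -> 0 < #|A| <= 2.
Proof.
rewrite ffunE => /card_gt0P[X /imsetP[t]]; rewrite inE => /is_threadP.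
by case=> u [v [ts [-> _ _ _ _]]] _; rewrite cards2; case: eqP.
Qed.

Lemma induced_card (g : mgraph I) S (A : {set sub S}) :
  0 < [ffun B : {set sub S} => g (val @: B)] A -> 0 < #|A| <= 2.
Proof. by rewrite ffunE => /mult_card; rewrite card_imset //; apply: val_inj. Qed.

Definition union_mult S (x : mgraph (sub S)) (y : mgraph (sub (~: S)))
    (A : {set I}) : nat :=
  if A \subset S then x (val @^-1: A)
  else if A \subset ~: S then y (val @^-1: A) else 0.

Lemma union_card S (x : mgraph (sub S)) (y : mgraph (sub (~: S))) A :
  0 < [ffun B => union_mult x y B] A -> 0 < #|A| <= 2.
Proof.
rewrite ffunE /union_mult; case: ifP => [AS /mult_card|_].
  by rewrite -[in X in _ -> X](sub_preimset AS) card_imset //; apply: val_inj.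
case: ifP => // AS /mult_card.
by rewrite -[in X in _ -> X](sub_preimset AS) card_imset //; apply: val_inj.
Qed.

Definition restrict_graph (g : mgraph I) S : mgraph (sub S) :=
  MGraph (@restrict_card g S).

Definition induced_graph (g : mgraph I) S : mgraph (sub S) :=
  MGraph (@induced_card g S).

Definition union_graph S (x : mgraph (sub S)) (y : mgraph (sub (~: S))) :
  mgraph I := MGraph (@union_card S x y).

Lemma strand_rot (g : mgraph I) s u : u \in s -> strand g s (cycle_edges s) ->
  exists s', [/\ strand g (u :: s') (cycle_edges (u :: s')) & u :: s' =i s].
Proof.
move=> us [uniqs _ gL]; case/rot_to: us => i s' rE; exists s'.
have sE : u :: s' =i s by move=> x; rewrite -rE mem_rot.
split=> //; split; [by rewrite -rE rot_uniq | by right|].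
move=> A x xA; rewrite sE => /(gL A x xA) ->.
by apply/permP; rewrite -rE perm_sym perm_cycle_edges_rot.
Qed.

Lemma strand_full (g : mgraph I) s L : strand g s L ->
  exists Es : seq (edge g), [/\ uniq Es, map tag Es = L
    & forall (e : edge g) x, x \in tag e -> x \in s -> e \in Es].
Proof.
case=> us sL gL; have [A AL|Es [uE tE memE]] := @edge_enum _ g L.
  have /set0Pn[x xA] : A != set0.
    by case: sL AL => -> /mapP[[x y] _ ->]; apply/set0Pn; exists x; rewrite set21.
  by rewrite (gL A x) ?(strand_edges_mem sL AL).
exists Es; split=> // e x xe xs; rewrite memE -(gL _ x) //.
Qed.

Lemma restrict_pc (g : mgraph I) S :
  paths_and_cycles g -> paths_and_cycles (restrict_graph g S).
Proof.
move=> /paths_and_cyclesP gP; apply/paths_and_cyclesP=> u.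
have [s [L [gs us]]] := gP (val u); have uS : val u \in S := valP u.
case: (gs) => uniqs [LE|LE] gL; rewrite {L}LE in gs gL.
- have [Es [uE tE full]] := strand_full gs.
  have hS : has (mem S) s by apply/hasP; exists (val u).
  have [s' s'E] : exists s' : seq (sub S), map val s' = filter (mem S) s.
    by apply: lift_seq; apply: filter_all.
  have us' : u \in s'.
    by rewrite -(mem_map val_inj) s'E mem_filter /= uS.
  exists s', (path_edges s'); split=> //; split; [|by left|].
    by rewrite -(map_inj_uniq val_inj) s'E filter_uniq.
  move=> A x xA xs'; rewrite ffunE.
  have xs : val x \in s.
    by move: xs'; rewrite -(mem_map val_inj) s'E mem_filter => /andP[].
  case/split_find: hS s'E tE full xs uniqs {gs us gL} => a pre q aS npre s'E tE full xs uniqs.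
  rewrite cat_rcons in s'E tE full xs uniqs.
  rewrite (@count_threads _ g S Es pre a q) //; first last.
  + by exists x.
  + by rewrite filter_uniq.
  + by rewrite all_predC.
  rewrite -(count_mem_imset _ _ val_inj) -path_edges_map s'E filter_cat /=.
  by rewrite (aS : a \in S); move: npre; rewrite has_filter negbK => /eqP->.
- have [q [gs' _]] := strand_rot us gs; have [Es [uE tE full]] := strand_full gs'.
  have [s' s'E] : exists s' : seq (sub S), map val s' = filter (mem S) (val u :: q).
    by apply: lift_seq; apply: filter_all.
  have us' : u \in s'.
    by rewrite -(mem_map val_inj) s'E mem_filter /= uS mem_head.
  case: gs' => uq _ _.
  exists s', (cycle_edges s'); split=> //; split; [|by right|].
    by rewrite -(map_inj_uniq val_inj) s'E filter_uniq.
  move=> A x xA xs'; rewrite ffunE.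
  have xs : val x \in val u :: q.
    by move: xs'; rewrite -(mem_map val_inj) s'E mem_filter => /andP[].
  have qu : val u :: rcons q (val u) =i val u :: q.
    by move=> y; rewrite !inE mem_rcons inE; case: eqP.
  rewrite (@count_threads _ g S Es [::] (val u) (rcons q (val u))) //; first last.
  + by exists x => //=; rewrite qu.
  + by move=> e y ye; rewrite qu; apply: full.
  + rewrite /= uS /= filter_rcons /= uS /= filter_uniq //.
    by case/andP: uq.
  + by rewrite tE cycle_edges_cons.
  rewrite -(count_mem_imset _ _ val_inj) -cycle_edges_map s'E /= uS.
  by rewrite cycle_edges_cons filter_rcons /= uS.
Qed.

Lemma path_run (T : {set I}) p u : uniq (filter (mem T) p) -> u \in T -> u \in p ->
  exists R : seq I, [/\ u \in R, uniq R, all (mem T) R, {subset R <= p} &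
    forall (A : {set I}) x, A \subset T -> x \in A -> x \in R ->
      count_mem A (path_edges p) = count_mem A (path_edges R)].
Proof.
move=> + uT; have [n] := ubnP (size p); elim: n p => // n IHn p pn uTp up.
have [hT|nT] := boolP (has [predC T] p); last first.
  have aT : all (mem T) p by rewrite -[all _ _]negbK -has_predC.
  by exists p; split=> //; rewrite -(all_filterP aT).
case/split_find: hT pn uTp up => z B p2 zT nB.
rewrite cat_rcons => pn uTp up.
have BT : all (mem T) B by rewrite -[all _ _]negbK -has_predC.
move: (uTp); rewrite filter_cat cat_uniq (all_filterP BT) => /and3P[uB /hasPn dB].
rewrite /= (negPf (zT : z \notin T)) => up2.
have cz (A : {set I}) l : A \subset T -> count_mem A (path_edges (z :: l)) = count_mem A (path_edges l).
  case: l => // w l AT; rewrite path_edges_cons2 /=.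
  by case: eqP => // zA; case/negP: zT; rewrite /= (subsetP AT) // -zA set21.
have czr (A : {set I}) l : A \subset T -> count_mem A (path_edges (rcons l z)) = count_mem A (path_edges l).
  move=> AT; rewrite -count_rev -path_edges_rev rev_rcons cz //.
  by rewrite path_edges_rev count_rev.
have cnt (A : {set I}) : A \subset T -> count_mem A (path_edges (B ++ z :: p2)) =
   count_mem A (path_edges B) + count_mem A (path_edges p2).
  by move=> AT; rewrite path_edges_cat count_cat czr // cz.
have disj x : x \in B -> x \in p2 -> False.
  move=> xB xp; have xT : x \in T := allP BT x xB.
  by have /dB/= : x \in filter (mem T) (z :: p2);
    rewrite ?xB // mem_filter /= xT inE xp orbT.
have out (A : {set I}) x (l : seq I) : x \in A -> x \notin l -> count_mem A (path_edges l) = 0.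
  by move=> xA xl; apply/count_memPn; apply: contra xl => /path_edges_mem; apply.
move: up; rewrite mem_cat inE => /or3P[uB'|/eqP uz|up].
- exists B; split=> // [x xB|A x AT xA xB]; first by rewrite mem_cat xB.
  by rewrite cnt // (out _ x p2) ?addn0 //; apply/negP; apply: disj.
- by case/negP: zT; rewrite -uz.
have pn2 : size p2 < n.
  by move: pn; rewrite size_cat addnS ltnS; apply: leq_ltn_trans; apply: leq_addl.
have [R [uR uniqR RT Rp RA]] := IHn p2 pn2 up2 up.
exists R; split=> // [x /Rp xp|A x AT xA xR]; first by rewrite mem_cat inE xp !orbT.
rewrite cnt // (out _ x B) ?add0n ?(RA _ x) //.
by apply/negP=> xB; apply: disj xB (Rp _ xR).
Qed.

Lemma induced_pc (g : mgraph I) S :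
  paths_and_cycles g -> paths_and_cycles (induced_graph g S).
Proof.
move=> /paths_and_cyclesP gP; apply/paths_and_cyclesP=> u.
have [s [L [gs us]]] := gP (val u); have uS : val u \in S := valP u.
have run p : (forall (A : {set I}) x, x \in A -> x \in p -> g A = count_mem A (path_edges p)) ->
    val u \in p -> uniq (filter (mem S) p) ->
    exists s L, strand (induced_graph g S) s L /\ u \in s.
  move=> gp up uSp; have [R [uR uniqR /lift_seq[r rE] Rp RA]] := path_run uSp uS up.
  exists r, (path_edges r); split; last by rewrite -(mem_map val_inj) rE.
  split; [by rewrite -(map_inj_uniq val_inj) rE | by left|] => A x xA xr.
  have xR : val x \in R by rewrite -rE map_f.
  rewrite ffunE (gp _ (val x)) ?imset_f ?Rp // (RA _ (val x)) ?sub_imset ?imset_f //.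
  by rewrite -rE path_edges_map count_mem_imset //; apply: val_inj.
case: (gs) => uniqs [LE|LE] gL; rewrite {L}LE in gs gL.
  by apply: run gL us _; rewrite filter_uniq.
have [/lift_seq[r rE]|/allPn[a as_ aS]] := boolP (all (mem S) s).
  exists r, (cycle_edges r); split; last by rewrite -(mem_map val_inj) rE.
  split; [by rewrite -(map_inj_uniq val_inj) rE | by right|] => A x xA xr.
  rewrite ffunE (gL _ (val x)) ?imset_f // -?rE ?map_f //.
  by rewrite cycle_edges_map count_mem_imset //; apply: val_inj.
have {}aS : a \notin S := aS.
have [q [[uq _ gq] qE]] := strand_rot as_ gs.
have qa : a :: rcons q a =i a :: q.
  by move=> y; rewrite !inE mem_rcons inE; case: eqP.
apply: (run (a :: rcons q a)) => [A x xA||].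
- by rewrite qa => /(gq _ _ xA) ->; rewrite cycle_edges_cons.
- by rewrite qa qE.
rewrite /= (negPf aS) filter_rcons /= (negPf aS) filter_uniq //.
by case/andP: uq.
Qed.

Lemma strand_image S (x : mgraph (sub S)) (g : mgraph I) s L :
    (forall A : {set I}, A \subset S -> g A = x (val @^-1: A)) ->
    (forall (A : {set I}) z, z \in A -> z \in S -> ~~ (A \subset S) -> g A = 0) ->
    strand x s L ->
  exists L', strand g (map val s) L'.
Proof.
move=> gin gout [us sL xL].
exists [seq val @: B | B : {set sub S} <- L]; split.
- by rewrite (map_inj_uniq val_inj).
- by case: sL => ->; [left; rewrite path_edges_map|right; rewrite cycle_edges_map].
move=> A z zA /mapP[w ws zw]; have zS : z \in S by rewrite zw; apply: valP.
have [AS|AS] := boolP (A \subset S); last first.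
  rewrite (gout _ z) //; apply/esym/count_memPn; apply: contra AS => /mapP[B _ ->].
  exact: sub_imset.
rewrite gin // (xL _ w) ?inE -?zw //.
by rewrite -[in RHS](sub_preimset AS) count_mem_imset //; apply: val_inj.
Qed.

Lemma union_pc S (x : mgraph (sub S)) (y : mgraph (sub (~: S))) :
  paths_and_cycles x -> paths_and_cycles y -> paths_and_cycles (union_graph x y).
Proof.
move=> /paths_and_cyclesP xP /paths_and_cyclesP yP; apply/paths_and_cyclesP=> u.
have [uS|uS] := boolP (u \in S).
  have [s [L [xs us]]] := xP (exist [in S] u uS).
  have [A AS|A z zA zS AS|L' gs] := strand_image (g := union_graph x y) _ _ xs.
  - by rewrite ffunE /union_mult AS.
  - rewrite ffunE /union_mult (negPf AS); case: ifP => // /subsetP/(_ z zA).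
    by rewrite inE zS.
  exists (map val s), L'; split=> //; exact: (map_f val us).
have uS' : u \in ~: S by rewrite inE.
have [s [L [ys us]]] := yP (exist [in ~: S] u uS').
have AC (A : {set I}) z : z \in A -> z \in ~: S -> (A \subset S) = false.
  by move=> zA zS; apply/negP=> /subsetP/(_ z zA) zS'; rewrite inE zS' in zS.
have [A AS|A z zA zS AS|L' gs] := strand_image (g := union_graph x y) _ _ ys.
- rewrite ffunE /union_mult AS; case: ifP => // AS'.
  have A0 : A = set0.
    apply/setP=> z; rewrite inE; apply/negP=> zA.
    by rewrite (AC A z) ?(subsetP AS) in AS'.
  have m0 (J : finType) (h : mgraph J) : h set0 = 0.
    by apply/eqP; rewrite -leqn0 leqNgt; apply/negP=> /mult_card; rewrite cards0.
  by rewrite A0 !preimset0 !m0.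
- by rewrite ffunE /union_mult (AC A z) // (negPf AS).
exists (map val s), L'; split=> //; exact: (map_f val us).
Qed.

End Closure.

Definition restriction (I : finType) (x : C I) (S : {set I}) : C (sub S) :=
  MkC (@restrict_pc I x S (graphP x)).

Definition induced (I : finType) (x : C I) (S : {set I}) : C (sub S) :=
  MkC (@induced_pc I x S (graphP x)).

Definition disjoint_union (I : finType) (S : {set I})
    (x : C (sub S)) (y : C (sub (~: S))) : C I :=
  MkC (union_pc (graphP x) (graphP y)).

Definition isomorphic (I J : finType) (x : C I) (y : C J) : Prop :=
  exists2 s : I -> J, bijective s & forall A : {set I}, y (s @: A) = x A.

Local Open Scope ring_scope.

(* A family of linear maps from the vector spaces spanned by the sets [C I],
   given by its values on these bases. *)
Definition functional_family (K : fieldType) : Type :=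
  forall I : finType, C I -> K.

Definition is_character (K : fieldType) (z : functional_family K) : Prop :=
  [/\ forall (I : finType) (x : C I), #|I| = 0%N -> z I x = 1,
      forall (I : finType) (S : {set I}) (x : C (sub S)) (y : C (sub (~: S))),
        z I (disjoint_union x y) = z (sub S) x * z (sub (~: S)) y
    & forall (I J : finType) (x : C I) (y : C J),
        isomorphic x y -> z I x = z J y].

(* The coproduct component of I = S + T is (x|_S, x/_S), where x/_S is the
   subgraph induced on T. *)
Definition convolution (K : fieldType) (z w : functional_family K) :
  functional_family K :=
  fun I x => \sum_(S : {set I})
    z (sub S) (restriction x S) * w (sub (~: S)) (induced x (~: S)).

Definition power_series (K : fieldType) : Type := nat -> K.

Definition series_mul (K : fieldType) (f g : power_series K) : power_series K :=
  fun n => \sum_(i < n.+1) f i * g (n - i)%N.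

Definition series_exp (K : fieldType) (f : power_series K) (k : nat) : power_series K :=
  iter k (series_mul f) (fun n => (n == 0%N)%:R).

(* When [g 0 = 0], the terms with k > n do not contribute to the coefficient
   of x^n in f(g(x)). *)
Definition series_comp (K : fieldType) (f g : power_series K) : power_series K :=
  fun n => \sum_(k < n.+1) f k * series_exp g k n.

Definition is_series_pair (K : fieldType) (p : power_series K * power_series K) : Prop :=
  [/\ p.1 0%N = 0, p.1 1%N = 1 & p.2 0%N = 0].

Definition pair_mul (K : fieldType) (p q : power_series K * power_series K) :
  power_series K * power_series K :=
  (series_comp p.1 q.1, fun n => series_comp p.2 q.1 n + q.2 n).

Definition is_group (T : Type) (D : T -> Prop) (mul : T -> T -> T) : Prop :=
  [/\ forall x y, D x -> D y -> D (mul x y),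
      forall x y z, D x -> D y -> D z -> mul x (mul y z) = mul (mul x y) z
    & exists2 e, D e & forall x, D x ->
        [/\ mul e x = x, mul x e = x
          & exists2 y, D y & mul y x = e /\ mul x y = e]].

Definition is_group_iso (T U : Type) (D : T -> Prop) (mulT : T -> T -> T)
    (E : U -> Prop) (mulU : U -> U -> U) (phi : T -> U) : Prop :=
  [/\ forall x, D x -> E (phi x),
      forall x y, D x -> D y -> phi x = phi y -> x = y,
      forall u, E u -> exists2 x, D x & phi x = u
    & forall x y, D x -> D y -> phi (mulT x y) = mulU (phi x) (phi y)].

(* Main.v *)
(* A character is multiplicative and isomorphism invariant, so it amounts to two
   sequences of scalars: its values a_n on the path and b_n on the cycle with n
   vertices, where a_0 = b_0 = 1 and the other values are arbitrary.  It
   corresponds to the pair g = sum a_n x^(n+1), h = sum (b_n / n) x^n.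

   A set S of k vertices of a path leaves k + 1 gaps, so that the path part of a
   convolution is the composition of the series g.  A nonempty S in an n-cycle
   leaves k cyclic gaps, and the gap through the base point, when it has length
   q, can be placed in q + 1 ways: the sum over all S of size k is the
   coefficient of x^(n-1) in g' g^(k-1), that is n/k times the coefficient of
   x^n in g^k.  The empty S contributes the term h_2.

   The series form a group since every g with g(0) = 0 and g'(0) = 1 admits the
   solution f of f(g(x)) = t(x) for every t, and the group laws are carried over
   to the characters. *)
Require Import Defs.
From mathcomp Require Import all_boot all_algebra.
From Stdlib Require Import FunctionalExtensionality.

Set Implicit Arguments.
Unset Strict Implicit.
Unset Printing Implicit Defensive.

Import GRing.Theory.
Local Open Scope ring_scope.

(** * Formal power series *)

Section Series.
Variable K : fieldType.
Implicit Types (f g h : power_series K) (p q : {poly K}).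

(** Congruence modulo x^N. Identities between power series are proved on polynomial truncations,
    where composition is known to be associative. *)
Definition coef_eq N p q := forall i, (i < N)%N -> p`_i = q`_i.

Lemma coef_eqM N p p' q q' :
  coef_eq N p p' -> coef_eq N q q' -> coef_eq N (p * q) (p' * q').
Proof.
move=> pp qq i iN; rewrite !coefM; apply: eq_bigr => -[j ji] _ /=.
by rewrite pp ?qq // (leq_ltn_trans _ iN) ?leq_subr.
Qed.

Lemma coef_eqX N p p' k : coef_eq N p p' -> coef_eq N (p ^+ k) (p' ^+ k).
Proof. by move=> pp; elim: k => // k IHk; rewrite !exprS; apply: coef_eqM. Qed.

Lemma coefX_small p k n : p`_0 = 0 -> (n < k)%N -> (p ^+ k)`_n = 0.
Proof.
move=> p0; elim: k n => // k IHk n nk; rewrite exprS coefM big1 // => -[[|j] jn] _ /=.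
  by rewrite p0 mul0r.
by rewrite IHk ?mulr0 //; case: n nk jn => // n nk _; rewrite subSS (leq_ltn_trans (leq_subr _ _)).
Qed.

(** Since [q ^+ k] has no term of degree below k, the sum can be cut at n whatever the degree of
    [p], which gives it the shape of [series_comp]. *)
Lemma coef_comp_ord p q n : q`_0 = 0 ->
  (p \Po q)`_n = \sum_(k < n.+1) p`_k * (q ^+ k)`_n.
Proof.
move=> q0; rewrite coef_comp_poly.
have pad M : (size p <= M)%N ->
    \sum_(i < size p) p`_i * (q ^+ i)`_n = \sum_(i < M) p`_i * (q ^+ i)`_n.
  move=> sM; rewrite (big_ord_widen M (fun i => p`_i * (q ^+ i)`_n) sM) big_mkcond.
  by apply: eq_bigr => i _; case: ltnP => // /(nth_default 0) ->; rewrite mul0r.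
rewrite (pad (maxn (size p) n.+1)) ?leq_maxl //.
rewrite (big_ord_widen _ (fun i => p`_i * (q ^+ i)`_n) (leq_maxr (size p) n.+1)).
rewrite [in RHS]big_mkcond; apply: eq_bigr => i _; case: ltnP => // ni.
by rewrite coefX_small ?mulr0.
Qed.

Lemma coef_eq_comp N p p' q q' : q`_0 = 0 -> q'`_0 = 0 ->
  coef_eq N p p' -> coef_eq N q q' -> coef_eq N (p \Po q) (p' \Po q').
Proof.
move=> q0 q0' pp qq i iN; rewrite !coef_comp_ord //; apply: eq_bigr => -[k ki] _ /=.
by rewrite pp ?(coef_eqX k qq) // (leq_ltn_trans _ iN).
Qed.

Definition trunc N f : {poly K} := \poly_(i < N) f i.

Lemma coef_trunc N f i : (i < N)%N -> (trunc N f)`_i = f i.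
Proof. by move=> iN; rewrite coef_poly iN. Qed.

Lemma coef0_trunc N f : f 0%N = 0 -> (trunc N f)`_0 = 0.
Proof. by rewrite coef_poly => ->; case: ifP. Qed.

Lemma trunc_mul N f g :
  coef_eq N (trunc N (series_mul f g)) (trunc N f * trunc N g).
Proof.
move=> i iN; rewrite coef_trunc // coefM; apply: eq_bigr => -[j ji] _ /=.
by rewrite !coef_trunc // (leq_ltn_trans _ iN) ?leq_subr.
Qed.

Lemma trunc_exp N f k : coef_eq N (trunc N (series_exp f k)) (trunc N f ^+ k).
Proof.
elim: k => [|k IHk] i iN; first by rewrite coef_trunc // expr0 coef1.
rewrite exprS -(coef_eqM (fun j _ => erefl (trunc N f)`_j) IHk) //.
exact: trunc_mul.
Qed.

Lemma trunc_comp N f g : g 0%N = 0 ->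
  coef_eq N (trunc N (series_comp f g)) (trunc N f \Po trunc N g).
Proof.
move=> g0 i iN; rewrite coef_trunc // coef_comp_ord ?coef0_trunc //.
apply: eq_bigr => -[k ki] _ /=.
by rewrite coef_trunc ?(leq_ltn_trans _ iN) // -trunc_exp // coef_trunc.
Qed.

Lemma trunc_eq f g : (forall N, coef_eq N (trunc N f) (trunc N g)) -> f = g.
Proof.
move=> fg; apply: functional_extensionality => n.
by have := fg n.+1 n (ltnSn n); rewrite !coef_trunc.
Qed.

Lemma series_comp0 f g : g 0%N = 0 -> series_comp f g 0%N = f 0%N.
Proof. by move=> g0; rewrite /series_comp big_ord1 /= mulr1. Qed.

Lemma series_exp_small f k n : f 0%N = 0 -> (n < k)%N -> series_exp f k n = 0.
Proof.
move=> f0 nk; have := @trunc_exp n.+1 f k n (ltnSn n).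
by rewrite coef_trunc // => ->; rewrite coefX_small ?coef0_trunc.
Qed.

Lemma series_exp_diag f n : f 0%N = 0 -> f 1%N = 1 -> series_exp f n n = 1.
Proof.
move=> f0 f1; elim: n => // n IHn.
rewrite /= /series_mul big_ord_recl f0 mul0r add0r big_ord_recl f1 mul1r.
rewrite big1 ?addr0 /bump /= ?subSS ?subn0 // => i _.
rewrite -/(series_exp f n) series_exp_small ?mulr0 //.
by case: n i {IHn} => [[]|n i] //; rewrite /bump /= !add1n !subSS ltnS leq_subr.
Qed.

(** This is [comp_polyA] modulo x^N for every N; the vanishing constant terms make composition
    compatible with the congruences. *)
Lemma series_compA f g h : g 0%N = 0 -> h 0%N = 0 ->
  series_comp f (series_comp g h) = series_comp (series_comp f g) h.
Proof.
move=> g0 h0; apply: trunc_eq => N i iN.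
have gh0 : (trunc N g \Po trunc N h)`_0 = 0.
  by rewrite coef_comp_ord ?coef0_trunc // big_ord1 coef0_trunc ?mul0r.
rewrite !trunc_comp ?series_comp0 //.
transitivity (trunc N f \Po (trunc N g \Po trunc N h))`_i.
  by apply: (coef_eq_comp (N := N)); rewrite ?coef0_trunc ?series_comp0 //; apply: trunc_comp.
rewrite comp_polyA; apply/esym; apply: (coef_eq_comp (N := N));
  by rewrite ?coef0_trunc //; apply: trunc_comp.
Qed.

Definition series_X : power_series K := fun n => (n == 1%N)%:R.

Lemma series_comp1 f : series_comp f series_X = f.
Proof.
apply: trunc_eq => N i iN; rewrite trunc_comp //.
rewrite (coef_eq_comp _ _ (fun j _ => erefl (trunc N f)`_j) (q' := 'X) (N := N)) ?comp_polyXr //;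
  rewrite ?coefX ?coef0_trunc //.
by move=> j jN; rewrite coef_trunc ?coefX.
Qed.

Lemma series_1comp f : f 0%N = 0 -> series_comp series_X f = f.
Proof.
move=> f0; apply: trunc_eq => N i iN; rewrite trunc_comp //.
rewrite (coef_eq_comp _ _ (p' := 'X) (N := N) _ (fun j _ => erefl (trunc N f)`_j)) ?comp_polyX //;
  rewrite ?coefX ?coef0_trunc //.
by move=> j jN; rewrite coef_trunc ?coefX.
Qed.

Lemma series_compDl f g h n :
  series_comp (fun i => f i + g i) h n = series_comp f h n + series_comp g h n.
Proof. by rewrite -big_split; apply: eq_bigr => i _; rewrite mulrDl. Qed.

(** The coefficient form of the derivative of f^(k+1), namely (k+1) f' f^k. *)
Lemma series_exp_deriv f k n :
  n.+1%:R * series_exp f k.+1 n.+1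
  = k.+1%:R * series_mul (fun i => i.+1%:R * f i.+1) (series_exp f k) n.
Proof.
(* Coefficient n of a derivative reads coefficient n + 1, hence the precision n + 2. *)
have [lt1 lt2] : (n < n.+2)%N /\ (n.+1 < n.+2)%N by [].
have := trunc_exp f k.+1 lt2; rewrite coef_trunc // => ->.
rewrite mulr_natl -coef_deriv deriv_exp /= coefMn mulr_natl; congr (_ *+ _).
rewrite coefM; apply: eq_bigr => -[i /= ?] _.
have ni : (n - i < n.+2)%N by rewrite ltnS (leq_trans (leq_subr _ _)).
rewrite coef_deriv coef_trunc // mulr_natl -(trunc_exp f k ni) coef_trunc //.
Qed.

(** By [series_exp_diag] the linear system for the coefficients of f is triangular with diagonal 1,
    so they are found one after the other. *)
Lemma series_comp_solve g (t : power_series K) : g 0%N = 0 -> g 1%N = 1 ->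
  exists f, series_comp f g = t.
Proof.
move=> g0 g1.
(* [L n] lists the first n coefficients of the solution. *)
pose fix L n := if n isn't n'.+1 then [::] else
  rcons (L n') (t n' - \sum_(k < n') (L n')`_k * series_exp g k n').
have sL n : size (L n) = n by elim: n => //= n IHn; rewrite size_rcons IHn.
pose f n := (L n.+1)`_n.
have Lf n k : (k < n)%N -> (L n)`_k = f k.
  elim: n => // n IHn; rewrite ltnS leq_eqVlt => /predU1P[->//|kn].
  by rewrite /= nth_rcons sL kn IHn.
exists f; apply: functional_extensionality => n.
rewrite /series_comp big_ord_recr /= series_exp_diag // mulr1.
rewrite {2}/f /= nth_rcons sL ltnn eqxx addrC.
by rewrite (eq_bigr (fun k : 'I_n => f k * series_exp g k n)) ?subrK // => k _; rewrite Lf.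
Qed.

End Series.

(** * Groups given by predicates, and the group of series pairs *)

Lemma is_group_of_linv (T : Type) (D : T -> Prop) mul (e : T) :
    (forall x y, D x -> D y -> D (mul x y)) ->
    (forall x y z, D x -> D y -> D z -> mul x (mul y z) = mul (mul x y) z) ->
    D e -> (forall x, D x -> mul e x = x) ->
    (forall x, D x -> mul x e = x) ->
    (forall x, D x -> exists2 y, D y & mul y x = e) ->
  is_group D mul.
Proof.
move=> Dm mA De m1 m2 linv; split=> //; exists e => // x Dx; split; auto.
have [y Dy yx] := linv x Dx; have [z Dz zy] := linv y Dy.
exists y => //; split=> //.
(* With z a left inverse of y, x = (z y) x = z (y x) = z. *)
have xz : x = z by rewrite -(m1 x Dx) -zy -mA // yx m2.
by rewrite {1}xz.
Qed.

(** Each law holds after applying [phi], and injectivity on [D] pulls it back. *)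
Lemma is_group_iso_group (T U : Type) (D : T -> Prop) mulT (E : U -> Prop) mulU phi :
    (forall x y, D x -> D y -> D (mulT x y)) ->
    is_group E mulU -> is_group_iso D mulT E mulU phi ->
  is_group D mulT.
Proof.
move=> Dm [Em mA [e Ee unit]] [DE phi_inj phi_surj phiM].
have [d Dd phid] := phi_surj e Ee.
apply: (@is_group_of_linv _ _ _ d) => // [x y z Dx Dy Dz|x Dx|x Dx|x Dx].
- by apply: phi_inj; rewrite ?phiM ?mA; auto.
- by apply: phi_inj; rewrite ?phiM ?phid; auto; case: (unit _ (DE _ Dx)).
- by apply: phi_inj; rewrite ?phiM ?phid; auto; case: (unit _ (DE _ Dx)).
have [_ _ [v Ev [vx _]]] := unit _ (DE _ Dx); have [y Dy yv] := phi_surj v Ev.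
by exists y => //; apply: phi_inj; rewrite ?phiM ?phid ?yv; auto.
Qed.

Lemma series_pair_group (K : fieldType) : is_group (@is_series_pair K) (@pair_mul K).
Proof.
apply: (@is_group_of_linv _ _ _ (@series_X K, fun _ => 0)).
- move=> [g1 h1] [g2 h2] [/= g10 g11 h10] [/= g20 g21 h20].
  split=> /=; rewrite ?series_comp0 // ?h10 ?h20 ?addr0 //.
  by rewrite /series_comp big_ord_recl big_ord1 g10 mul0r add0r g11 series_exp_diag ?mulr1.
- move=> [g1 h1] [g2 h2] [g3 h3] [/= g10 g11 h10] [/= g20 g21 h20] [/= g30 g31 h30].
  rewrite /pair_mul /= series_compA //; congr pair.
  apply: functional_extensionality => n.
  by rewrite series_compA // series_compDl addrA.
- by split.
- move=> [g h] [/= g0 g1 h0]; rewrite /pair_mul /= series_1comp //; congr pair.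
  apply: functional_extensionality => n.
  by rewrite /series_comp big1 ?add0r // => i _; rewrite mul0r.
- move=> [g h] [/= g0 g1 h0]; rewrite /pair_mul /= !series_comp1 //; congr pair.
  by apply: functional_extensionality => n; rewrite addr0.
move=> [g h] [/= g0 g1 h0].
(* The left inverse of (g, h) is given by g' o g = x and h' o g = -h. *)
have [g' g'g] := series_comp_solve (@series_X K) g0 g1.
have [h' h'g] := series_comp_solve (fun n => - h n) g0 g1.
exists (g', h'); rewrite /pair_mul /= ?g'g ?h'g; last first.
  by congr pair; apply: functional_extensionality => n; rewrite addNr.
have g'0 : g' 0%N = 0 by rewrite -(series_comp0 g' g0) g'g.
split=> //=; last by rewrite -(series_comp0 h' g0) h'g h0 oppr0.
have := congr1 (fun f => f 1%N) g'g.
by rewrite /series_comp big_ord_recl big_ord1 g'0 mul0r add0r series_exp_diag ?mulr1.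
Qed.

(** * Sums over subsets encoded as boolean masks *)

Section Masks.
Variable K : fieldType.
Implicit Types (a b : nat -> K) (f : seq bool -> K) (m : seq bool).

(** A subset of a list of vertices is encoded by its membership mask. Recursion on the first entry
    turns inductions on masks into recurrences for coefficients. *)
Fixpoint mask_sum n f : K :=
  if n is n'.+1 then mask_sum n' (f \o cons false) + mask_sum n' (f \o cons true)
  else f [::].

Lemma eq_mask_sum n f f' :
  (forall m, size m = n -> f m = f' m) -> mask_sum n f = mask_sum n f'.
Proof.
elim: n f f' => [|n IHn] f f' ff' /=; first exact: ff'.
by congr (_ + _); apply: IHn => m sm; apply: ff'; rewrite /= sm.
Qed.

Lemma mask_sumZ n c f : mask_sum n (fun m => c * f m) = c * mask_sum n f.
Proof. by elim: n f => //= n IHn f; rewrite mulrDr -!IHn. Qed.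

Lemma mask_sumD n f f' :
  mask_sum n (fun m => f m + f' m) = mask_sum n f + mask_sum n f'.
Proof. by elim: n f f' => //= n IHn f f'; rewrite addrACA -!IHn. Qed.

Lemma mask_sum_cat n1 n2 f f' :
  mask_sum (n1 + n2) (fun m => f (take n1 m) * f' (drop n1 m))
  = mask_sum n1 f * mask_sum n2 f'.
Proof.
elim: n1 f => [|n1 IHn] f; last by rewrite /= mulrDl -!IHn.
rewrite add0n -mask_sumZ; apply: eq_mask_sum => m _.
by rewrite take0 drop0.
Qed.

Lemma mask_sum_rcons n f :
  mask_sum n.+1 f = mask_sum n (fun m => f (rcons m false) + f (rcons m true)).
Proof.
elim: n f => // n IHn f.
exact: (congr2 +%R (IHn (f \o cons false)) (IHn (f \o cons true))).
Qed.

Lemma mask_sum_rev n f : mask_sum n (f \o rev) = mask_sum n f.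
Proof.
elim: n f => // n IHn f; rewrite [RHS]mask_sum_rcons mask_sumD /=.
by congr (_ + _); rewrite -[RHS]IHn; apply: eq_mask_sum => m _ /=; rewrite rev_cons.
Qed.

Lemma sum_subsets (I : finType) (s : seq I) f : uniq s ->
  \sum_(S : {set I} | S \subset s) f (map (mem S) s) = mask_sum (size s) f.
Proof.
elim: s f => [|x s IHs] f /= us.
  rewrite (big_pred1 set0) // => S.
  apply/subsetP/eqP=> [S0|-> y]; last by rewrite inE.
  by apply/setP=> y; rewrite inE; apply/negP=> /S0.
case/andP: us => xs us.
rewrite (bigID (fun S : {set I} => x \in S)) [LHS]addrC /=; congr (_ + _).
  rewrite -IHs //; apply: eq_big => [S|S /andP[_ /negPf /= ->]] //.
  apply/andP/idP => [[/subsetP Sxs xS]|/subsetP Ss].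
    apply/subsetP=> y yS; have := Sxs y yS; rewrite inE => /predU1P[yx|//].
    by rewrite -yx yS in xS.
  split; last by apply: contra xs => /Ss.
  by apply/subsetP=> y /Ss ys; rewrite inE ys orbT.
(* The subsets containing [x] are reindexed by removing [x]. *)
rewrite -IHs // (reindex_onto (fun S => x |: S) (fun S => S :\ x)) /=; last first.
  by move=> S /andP[_ xS]; rewrite setD1K.
apply: eq_big => [S|S].
  rewrite setU11 andbT; apply/andP/idP => [[/subsetP Sxs /eqP SE]|/subsetP Ss].
    apply/subsetP=> y yS; have yxS : y \in x |: S by rewrite inE yS orbT.
    have := Sxs y yxS; rewrite inE => /predU1P[yx|//].
    by move: yS; rewrite -SE yx !inE eqxx.
  have xS : x \notin S by apply: contra xs => /Ss.
  split; last by rewrite setU1K.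
  apply/subsetP=> y; rewrite !inE => /predU1P[->|/Ss ys]; first by rewrite eqxx.
  by rewrite ys orbT.
case/andP=> [_ /eqP SE]; rewrite /= setU11; congr (f (_ :: _)).
apply/eq_in_map => y ys; rewrite /= !inE; case: eqP => // yx.
by rewrite -yx ys in xs.
Qed.

(** The strands partition the vertices, so choosing S amounts to choosing a mask on each strand
    independently. *)
Lemma sum_prod_strands (I : finType) (P : seq (bool * seq I)) (f : bool -> seq bool -> K) :
    uniq (flatten (unzip2 P)) -> (forall x, x \in flatten (unzip2 P)) ->
  \sum_(S : {set I}) \prod_(k <- P) f k.1 (map (mem S) k.2)
  = \prod_(k <- P) mask_sum (size k.2) (f k.1).
Proof.
move=> uP memP.
(* [fP] cuts the mask of the concatenated strands back into blocks. *)
pose fP := foldr (fun k r m =>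
  f k.1 (take (size k.2) m) * r (drop (size k.2) m)) (fun=> 1) P.
transitivity (\sum_(S : {set I} | S \subset flatten (unzip2 P))
  fP (map (mem S) (flatten (unzip2 P)))).
  apply: eq_big => [S|S _]; first by apply/esym/subsetP => x _; apply: memP.
  rewrite /fP; elim: (P) => [|k Q IHQ] /=; first by rewrite big_nil.
  by rewrite big_cons map_cat take_size_cat ?drop_size_cat ?size_map ?IHQ.
rewrite sum_subsets // /fP; elim: (P) => [|k Q IHQ] /=; first by rewrite big_nil.
by rewrite size_cat mask_sum_cat IHQ big_cons.
Qed.

(* The entries [true] of a mask are the vertices of S; [gaps a i m] is the
   product of the weights of the maximal runs of [false], the first of which
   is prolonged by [i]. *)
Fixpoint gaps a i m : K :=
  if m is x :: m' then if x then a i * gaps a 0 m' else gaps a i.+1 m' else a i.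

(* Reversing the rest of the mask makes the last run, which is merged with the
   first one around the cycle, come first. *)
Fixpoint cyclic_gaps a b i m : K :=
  if m is x :: m' then if x then gaps a i (rev m') else cyclic_gaps a b i.+1 m'
  else b i.

(** Multiplication by x of the generating series: a gap is counted together with one adjacent vertex
    of S. *)
Definition shift a : power_series K := fun n => if n is n'.+1 then a n' else 0.

Lemma shift_mul a (f : power_series K) n :
  series_mul (shift a) f n.+1 = series_mul a f n.
Proof.
rewrite /series_mul big_ord_recl mul0r add0r; apply: eq_bigr => i _.
by rewrite /= /bump add1n subSS.
Qed.

Lemma series_mul_recl (f g : power_series K) n :
  series_mul f g n.+1 = f 0%N * g n.+1 + series_mul (f \o succn) g n.
Proof. by rewrite /series_mul big_ord_recl subn0; congr (_ + _). Qed.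

(** The first run gives the series of the a_(i+j); each entry [true], taken with the run after it,
    gives a factor x a(x). [A] is arbitrary because the induction shifts it at every [true]. *)
Lemma gaps_sum a (A : nat -> K) i n N : (n < N)%N ->
  mask_sum n (fun m => A (count id m) * gaps a i m)
  = \sum_(k < N) A k * series_mul (fun j => a (i + j)%N) (series_exp (shift a) k) n.
Proof.
elim: n A i N => [|n IHn] A i [|N] // nN /=.
  rewrite big_ord_recl big1 ?addr0.
    by rewrite /series_mul big_ord1 addn0 mulr1.
  by move=> k _; rewrite /series_mul big_ord1 series_exp_small ?mulr0.
rewrite (IHn A i.+1 N.+1) ?(ltnW nN) //.
under [X in _ + X]eq_mask_sum => m _ do rewrite /= add1n mulrCA.
rewrite mask_sumZ (IHn (A \o succn) 0 N) //.
under [RHS]eq_bigr => k _ do rewrite series_mul_recl addn0 mulrDr.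
rewrite big_split addrC; congr (_ + _); last first.
  apply: eq_bigr => k _; congr (_ * _); apply: eq_bigr => j _ /=.
  by rewrite addSnnS.
rewrite big_ord_recl /= mulr0 mulr0 add0r mulr_sumr; apply: eq_bigr => k _.
by rewrite /= mulrCA -shift_mul /bump add1n.
Qed.

(** When the run around the base point has length i + j, its j entries in the mask are distributed
    between the beginning and the end in j + 1 ways. The mask without [true] gives the term in
    [b]. *)
Lemma cyclic_gaps_sum a b (A : nat -> K) i n N : (n <= N)%N ->
  mask_sum n (fun m => A (count id m) * cyclic_gaps a b i m)
  = A 0%N * b (i + n)%N
    + \sum_(k < N) A k.+1 * \sum_(j < n) j.+1%:R * a (i + j)%N
                               * series_exp (shift a) k (n - j.+1)%N.
Proof.
elim: n i => [|n IHn] i nN /=.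
  by rewrite addn0 big1 ?addr0 // => k _; rewrite big_ord0 mulr0.
rewrite (IHn i.+1 (ltnW nN)) -addrA addSnnS; congr (_ + _).
under [X in _ + X]eq_mask_sum => m _ do rewrite /= add1n -count_rev.
(* The sum is invariant under reversal, so [gaps_sum] handles the masks that start with [true]. *)
rewrite (mask_sum_rev n (fun m => A (count id m).+1 * gaps a i m)).
rewrite (gaps_sum a (A \o succn) i nN) -big_split.
apply: eq_bigr => k _ /=; rewrite -mulrDr; congr (_ * _).
(* The factor j + 1 is j from the masks that start with [false] plus 1 from those that start with
   [true]. *)
rewrite /series_mul big_ord_recl [in RHS]big_ord_recl mul1r subn1 subn0 /= addrCA.
congr (_ + _); rewrite -big_split; apply: eq_bigr => j _ /=.
by rewrite /bump add1n addSnnS subSS [in RHS]mulrSr !mulrDl mul1r.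
Qed.

(** The convolution on one strand: the vertices in S form a strand of the same kind, and the
    complement breaks into the gaps. *)
Definition conv_weight (w w' : bool -> nat -> K) (t : bool) (n : nat) : K :=
  mask_sum n (fun m => w t (count id m) *
    if t then cyclic_gaps (w' false) (w' true) 0 m else gaps (w' false) 0 m).

(** At n = 0 the division by zero returns 0, the constant term required of h. *)
Definition series_of_weight (w : bool -> nat -> K) : power_series K * power_series K :=
  (shift (w false), fun n => w true n / n%:R).

Lemma series_of_conv_weight w w' : [pchar K] =i pred0 -> w true 0%N = 1 ->
  series_of_weight (conv_weight w w')
  = pair_mul (series_of_weight w) (series_of_weight w').
Proof.
move=> /pcharf0P charK w0; congr pair; apply: functional_extensionality => -[|n] /=.
- by rewrite series_comp0.
- rewrite /conv_weight (gaps_sum _ _ _ (ltnSn n)) /series_comp [RHS]big_ord_recl mul0r add0r.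
  by apply: eq_bigr => k _; rewrite -shift_mul.
- by rewrite series_comp0 //= invr0 !mulr0 addr0.
rewrite /conv_weight (cyclic_gaps_sum _ _ _ _ (leqnn _)) w0 mul1r add0n.
rewrite mulrDl addrC; congr (_ + _).
rewrite /series_comp [RHS]big_ord_recl /= invr0 !mulr0 add0r mulr_suml.
apply: eq_bigr => k _; rewrite /= -!mulrA; congr (_ * _).
have nz i : i.+1%:R != 0 :> K by rewrite charK.
(* After multiplication by n + 1 the two sides agree by [series_exp_deriv], once its factor k + 1 is
   cancelled. *)
apply: (mulfI (nz n)); rewrite mulrCA divff // mulr1 mulrCA.
by rewrite [X in _ * X](@series_exp_deriv K (shift (w' false)) k n) mulKf ?nz.
Qed.

End Masks.

(** * Decompositions of graphs into strands *)

Lemma flatten_uniq_inj (I : eqType) (P : seq (bool * seq I)) k k' x :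
    uniq (flatten (unzip2 P)) -> k \in P -> k' \in P -> x \in k.2 -> x \in k'.2 ->
  k = k'.
Proof.
elim: P => //= k0 P IHP; rewrite cat_uniq => /and3P[_ /hasPn disj uP].
have out k1 : k1 \in P -> x \in k1.2 -> x \notin k0.2.
  by move=> k1P xk1; apply: disj; apply/flattenP; exists k1.2; rewrite ?map_f.
rewrite !inE => /predU1P[->|kP] /predU1P[->|k'P] // xk xk'; last exact: IHP.
  by have := out _ k'P xk'; rewrite xk.
by have := out _ kP xk; rewrite xk'.
Qed.

Lemma flatten_uniq_mem (I : eqType) (P : seq (bool * seq I)) k :
  uniq (flatten (unzip2 P)) -> k \in P -> uniq k.2.
Proof.
elim: P => //= k0 P IHP; rewrite cat_uniq inE => /and3P[uk _ uP].
by case/predU1P=> [->|/IHP->].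
Qed.

Lemma mem_flatten_strands (I : eqType) (P : seq (bool * seq I)) x :
  reflect (exists2 k, k \in P & x \in k.2) (x \in flatten (unzip2 P)).
Proof.
apply: (iffP flattenP) => [[_ /mapP[k kP ->] xk]|[k kP xk]]; first by exists k.
by exists k.2; rewrite ?map_f.
Qed.

Lemma mult0 (I : finType) (g : mgraph I) : g set0 = 0%N.
Proof. by apply/eqP; rewrite -leqn0 leqNgt; apply/negP=> /mult_card; rewrite cards0. Qed.

Definition map_strand (I J : Type) (f : I -> J) (k : bool * seq I) : bool * seq J :=
  (k.1, map f k.2).

Lemma flatten_map_strand (I J : Type) (f : I -> J) (P : seq (bool * seq I)) :
  flatten (unzip2 (map (map_strand f) P)) = map f (flatten (unzip2 P)).
Proof. by elim: P => //= k P ->; rewrite map_cat. Qed.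

Section Presentation.
Variable I : finType.
Implicit Types (g : mgraph I) (k : bool * seq I) (P : seq (bool * seq I)).
Implicit Types (A T : {set I}).

(* The flag of a strand tells the cycles ([true]) from the paths. *)
Definition kind_edges k : seq {set I} :=
  if k.1 then cycle_edges k.2 else path_edges k.2.

Lemma kind_edgesP k : strand_edges k.2 (kind_edges k).
Proof. by case: k => [[] s]; [right|left]. Qed.

(* Only the edges inside T are constrained: the strands cut out of those of g
   describe the subgraph that g induces on T. *)
Definition presents_in T g P :=
  [/\ uniq (flatten (unzip2 P)), flatten (unzip2 P) =i T
    & forall k A x, k \in P -> A \subset T -> x \in A -> x \in k.2 ->
        g A = count_mem A (kind_edges k)].

Definition presents := presents_in setT.

Lemma presents_strand g P k : presents g P -> k \in P -> strand g k.2 (kind_edges k).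
Proof.
case=> uP _ gP kP; split; [exact: flatten_uniq_mem uP kP|exact: kind_edgesP|].
by move=> A x; apply: gP.
Qed.

Lemma presents_mem g P x : presents g P -> exists2 k, k \in P & x \in k.2.
Proof. by case=> _ memP _; apply/mem_flatten_strands; rewrite memP inE. Qed.

(** The strand of each vertex not yet covered is added in turn. Strands sharing a vertex fill the
    same component, so a new one is disjoint from the others. *)
Lemma presents_exists g : paths_and_cycles g -> exists P, presents g P.
Proof.
move/paths_and_cyclesP=> gP.
suff [P [uP subP strP]] : exists P, [/\ uniq (flatten (unzip2 P)),
    {subset enum I <= flatten (unzip2 P)}
  & forall k, k \in P -> strand g k.2 (kind_edges k)].
  exists P; split=> // [x|k A x kP _ xA xk]; first by rewrite inE subP ?mem_enum.
  by have [_ _ gk] := strP k kP; apply: gk xk.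
elim: (enum I) => [|x l [P [uP subP strP]]]; first by exists [::].
have [xP|xP] := boolP (x \in flatten (unzip2 P)).
  by exists P; split=> // y; rewrite inE => /predU1P[->|/subP].
have [s [L [gs xs]]] := gP x.
have [t tL] : exists t, L = kind_edges (t, s).
  by case: gs => _ [] -> _; [exists false | exists true].
exists ((t, s) :: P); split=> /=.
- rewrite cat_uniq uP andbT; case: (gs) => -> _ _ /=; apply/hasPn=> y yP.
  have [k kP yk] := mem_flatten_strands _ _ yP.
  apply: contra xP => ys; apply/mem_flatten_strands; exists k => //.
  rewrite (strand_component (strP k kP) yk) -(strand_component gs) //.
- by move=> y; rewrite inE mem_cat => /predU1P[->|/subP->]; rewrite ?xs ?orbT.
by move=> k; rewrite inE => /predU1P[->|/strP//]; rewrite -tL.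
Qed.

Lemma size_kind_edges k : k.2 != [::] -> (size k.2 == size (kind_edges k)) = k.1.
Proof.
case: k => [[] [|x s]] //= _; rewrite /kind_edges /= size_map size_zip.
  by rewrite size_rot minnn eqxx.
by rewrite /= (minn_idPr (leqnSn _)) gtn_eqF.
Qed.

Lemma sum_count_mem A (L : seq {set I}) : (forall B, B \in L -> B \subset A) ->
  \sum_(B : {set I} | B \subset A) count_mem B L = size L.
Proof.
elim: L => [|B L IHL] LA /=; first by rewrite big1.
rewrite big_split IHL /=; last by move=> B' B'L; apply: LA; rewrite inE B'L orbT.
by rewrite (bigD1 B) ?LA ?mem_head //= eqxx big1 // => B' /andP[_]; rewrite eq_sym => /negPf->.
Qed.

(** An intrinsic test by counting edges, meant for components, so that [weight_family] depends on no
    chosen presentation. *)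
Definition is_cycle g A : bool := #|A| == \sum_(B : {set I} | B \subset A) g B.

Lemma is_cycle_strand g k : k.2 != [::] -> strand g k.2 (kind_edges k) ->
  is_cycle g [set x in k.2] = k.1.
Proof.
move=> k0 [uk kE gk]; rewrite /is_cycle cardsE (card_uniqP uk) -size_kind_edges //.
congr (_ == _); rewrite -(@sum_count_mem [set x in k.2]) => [|B BL]; last first.
  by apply/subsetP=> x xB; rewrite inE (strand_edges_mem kE BL).
apply: eq_bigr => B /subsetP Bk; have [->|[x xB]] := set_0Vmem B; last first.
  by apply: (gk B x) => //; have := Bk x xB; rewrite inE.
rewrite mult0; apply/esym/count_memPn; apply/negP.
by case: kE => -> /mapP[[x y] _ /setP/(_ x)]; rewrite !inE eqxx.
Qed.

End Presentation.

Definition weight_family (K : fieldType) (w : bool -> nat -> K) : functional_family K :=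
  fun I x => \prod_(X in [set component x u | u : I]) w (is_cycle x X) #|X|.

Lemma weight_familyE (K : fieldType) (w : bool -> nat -> K) (I : finType) (x : C I) P :
    (forall t, w t 0%N = 1) -> presents x P ->
  weight_family w x = \prod_(k <- P) w k.1 (size k.2).
Proof.
move=> w0 xP; pose nz (k : bool * seq I) := k.2 != [::].
pose supp (k : bool * seq I) : {set I} := [set y in k.2].
have [uP _ _] := xP.
(* Empty strands, which cutting and restricting produce, weigh 1; the others correspond one to one
   to the components. *)
have -> : \prod_(k <- P) w k.1 (size k.2) = \prod_(k <- filter nz P) w k.1 (size k.2).
  rewrite big_filter [RHS]big_mkcond; apply: eq_bigr => -[t [|y s]] _ //=.
have str k : k \in P -> strand x k.2 (kind_edges k) by apply: presents_strand.
have suppE k u : k \in P -> u \in k.2 -> supp k = component x u.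
  by move=> kP uk; apply/setP=> y; rewrite inE (strand_component (str k kP) uk).
have nzP k : nz k -> exists u, u \in k.2.
  by case: k => t [|u s] // _; exists u; rewrite mem_head.
have -> : weight_family w x = \prod_(X <- map supp (filter nz P)) w (is_cycle x X) #|X|.
  rewrite /weight_family -big_enum; apply: perm_big; apply: uniq_perm.
  - exact: enum_uniq.
  - rewrite map_inj_in_uniq => [|k k'].
      elim: (P) uP => //= k Q IHQ; rewrite cat_uniq => /and3P[_ /hasPn disj /IHQ].
      case: ifP => // /nzP[u uk] /= ->; rewrite andbT mem_filter negb_and.
      apply/orP; right; apply/negP=> kQ; have /disj/= : u \in flatten (unzip2 Q).
        by apply/mem_flatten_strands; exists k.
      by rewrite uk.
    rewrite !mem_filter => /andP[/nzP[u uk] kP] /andP[_ k'P] /setP/(_ u).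
    by rewrite !inE uk => /esym uk'; apply: flatten_uniq_inj uP kP k'P uk uk'.
  move=> X; rewrite mem_enum; apply/imsetP/mapP=> [[u _ ->]|[k]].
    have [k kP uk] := presents_mem u xP; exists k; last by rewrite (suppE k u).
    by rewrite mem_filter kP /nz; case: (k.2) uk.
  by rewrite mem_filter => /andP[/nzP[u uk] kP] ->; exists u; rewrite ?(suppE k u).
rewrite big_map; apply: eq_big_seq => k; rewrite mem_filter => /andP[kn kP].
have sk := str k kP; rewrite is_cycle_strand // cardsE.
by case: sk => /card_uniqP->.
Qed.

(** * Transport of strands along injections *)

Section Transport.
Variables (I J : finType) (f : J -> I).
Hypothesis f_inj : injective f.

Lemma kind_edges_map k :
  kind_edges (map_strand f k) = [seq f @: B | B : {set J} <- kind_edges k].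
Proof.
by case: k => [[] s]; rewrite /kind_edges /= ?cycle_edges_map ?path_edges_map.
Qed.

Lemma imset_preimset (A : {set I}) : A \subset f @: setT -> f @: (f @^-1: A) = A.
Proof.
move=> /subsetP AT; apply/setP=> x; apply/imsetP/idP=> [[u + ->]|xA].
  by rewrite inE.
by have /imsetP[u _ xE] := AT x xA; exists u; rewrite // inE -xE.
Qed.

Lemma count_kind_edges_map k (A : {set I}) :
  count_mem A (kind_edges (map_strand f k))
  = if A \subset f @: setT then count_mem (f @^-1: A) (kind_edges k) else 0%N.
Proof.
rewrite kind_edges_map; case: ifPn => [AT|AT].
  by rewrite -{1}(imset_preimset AT) count_mem_imset.
apply/count_memPn; apply: contra AT => /mapP[B _ ->].
by rewrite imsetS ?subsetT.
Qed.

(** Applied to [val], whose image is a vertex subset, and to bijections, whose image is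
    everything. *)
Lemma presents_imset (g : mgraph I) (h : mgraph J) P :
    (forall A, h A = g (f @: A)) ->
  presents_in (f @: setT) g (map (map_strand f) P) <-> presents h P.
Proof.
move=> hg; rewrite /presents /presents_in flatten_map_strand (map_inj_uniq f_inj).
split=> -[uP memP gP]; split=> //.
- by move=> x; rewrite -(mem_map f_inj) memP imset_f inE.
- move=> k A x kP _ xA xk.
  rewrite hg (gP (map_strand f k) (f @: A) (f x)) ?map_f ?imset_f ?imsetS ?subsetT //.
  by rewrite kind_edges_map count_mem_imset.
- move=> x; apply/mapP/imsetP=> [[u _ ->]|[u _ ->]]; exists u => //.
  by rewrite memP inE.
move=> _ A y /mapP[k kP ->] AT yA /mapP[x xk yE].
by rewrite count_kind_edges_map AT -(gP k _ x) ?subsetT ?inE ?hg ?imset_preimset -?yE.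
Qed.

End Transport.

Lemma presents_isomorphic (I J : finType) (x : C I) (y : C J) (f : I -> J) P :
    bijective f -> presents x P -> presents y (map (map_strand f) P) ->
  isomorphic x y.
Proof.
move=> f_bij xP [_ _ yP]; exists f => // A; have f_inj := bij_inj f_bij.
have [->|[u uA]] := set_0Vmem A; first by rewrite imset0 !mult0.
have [k kP uk] := presents_mem u xP; have [_ _ gP] := xP.
rewrite (yP (map_strand f k) _ (f u)) ?map_f ?imset_f ?subsetT //.
by rewrite kind_edges_map count_mem_imset // (gP k A u) ?subsetT.
Qed.

Lemma isomorphic_presents (I J : finType) (x : C I) (y : C J) P :
    isomorphic x y -> presents x P ->
  exists f : I -> J, presents y (map (map_strand f) P).
Proof.
case=> f f_bij yx xP; exists f; have f_inj := bij_inj f_bij.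
have -> : presents y = presents_in (f @: setT) y.
  congr presents_in; apply/setP=> u; rewrite inE; apply/esym/imsetP.
  by case: f_bij => g _ gK; exists (g u); rewrite ?gK.
by apply/(presents_imset f_inj (h := x)).
Qed.

Lemma val_setT (I : finType) (S : {set I}) : [set val u | u in [set: sub S]] = S.
Proof.
apply/setP=> x; apply/imsetP/idP=> [[u _ ->]|xS]; first exact: valP.
by exists (exist [in S] x xS).
Qed.

Lemma lift_strands (I : finType) (S : {set I}) (P : seq (bool * seq I)) :
    {subset flatten (unzip2 P) <= S} ->
  exists Q : seq (bool * seq (sub S)), map (map_strand val) Q = P.
Proof.
elim: P => [|[t s] P IHP] /= PS; first by exists [::].
have [|Q QE] := IHP; first by move=> x xP; apply: PS; rewrite mem_cat xP orbT.
have [|s' s'E] := @lift_seq _ S s.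
  by apply/allP=> x xs; apply: PS; rewrite mem_cat xs.
by exists ((t, s') :: Q); rewrite /= QE /map_strand /= s'E.
Qed.

Lemma presents_induced (I : finType) (S : {set I}) (g : mgraph I) P :
    presents_in S g P ->
  exists2 Q, map (map_strand val) Q = P & presents (induced_graph g S) Q.
Proof.
move=> gP; have [x|Q QE] := @lift_strands _ S P; first by case: gP => _ ->.
exists Q => //; apply/(presents_imset val_inj (g := g)) => [A|]; first by rewrite ffunE.
by rewrite val_setT QE.
Qed.

Lemma presents_union (I : finType) (S : {set I}) (x : mgraph (sub S))
    (y : mgraph (sub (~: S))) P Q :
    presents x P -> presents y Q ->
  presents (union_graph x y) (map (map_strand val) P ++ map (map_strand val) Q).
Proof.
move=> [uP memP xP] [uQ memQ yQ].
have valS (u : sub S) : val u \in S by apply: valP.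
have valC (u : sub (~: S)) : val u \in ~: S by apply: valP.
rewrite /presents /presents_in /unzip2 map_cat flatten_cat !flatten_map_strand; split.
- rewrite cat_uniq !(map_inj_uniq val_inj) uP uQ /= andbT.
  apply/hasPn=> _ /mapP[v _ ->]; apply/mapP=> -[u _ uv].
  by have := valC v; rewrite inE (_ : val v = val u) ?valS.
- move=> u; rewrite inE mem_cat; apply/orP; have [uS|uS] := boolP (u \in S); [left|right].
    by apply/mapP; exists (exist [in S] u uS) => //; rewrite memP inE.
  have uS' : u \in ~: S by rewrite inE.
  by apply/mapP; exists (exist [in ~: S] u uS') => //; rewrite memQ inE.
move=> k A u; rewrite mem_cat => /orP[] /mapP[k' k'P ->] _ uA /mapP[v vk uE];
  rewrite count_kind_edges_map ?val_setT ?ffunE /union_mult; try exact: val_inj.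
  case: ifP => [AS|_]; first by apply: (xP _ _ v); rewrite ?subsetT ?inE -?uE.
  by case: ifP => // /subsetP/(_ u uA); rewrite inE (_ : u = val v) ?valS.
rewrite ifF; last first.
  apply/negP=> /subsetP/(_ u uA) uS.
  by have := valC v; rewrite inE (_ : val v = u) ?uS.
by case: ifP => // AS; apply: (yQ _ _ v); rewrite ?subsetT ?inE -?uE.
Qed.

(** * Characters and their values on paths and cycles *)

Section Standard.
Variables (t : bool) (n : nat).

Lemma standard_card (A : {set 'I_n}) :
  (0 < [ffun B : {set 'I_n} => count_mem B (kind_edges (t, enum 'I_n))] A ->
   0 < #|A| <= 2)%N.
Proof.
rewrite ffunE -has_count has_pred1 => AL.
have /mapP[[u v] _ ->] : A \in [seq [set e.1; e.2] | e <-
    zip (enum 'I_n) (if t then rot 1 (enum 'I_n) else behead (enum 'I_n))].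
  by move: AL; rewrite /kind_edges; case: t.
by rewrite cards2; case: eqP.
Qed.

Definition standard_graph : mgraph 'I_n := MGraph standard_card.

Lemma standard_pc : paths_and_cycles standard_graph.
Proof.
apply/paths_and_cyclesP=> u; exists (enum 'I_n), (kind_edges (t, enum 'I_n)).
rewrite mem_enum; split=> //; split; [exact: enum_uniq|exact: (kind_edgesP (t, _))|].
by move=> A x _ _; rewrite ffunE.
Qed.

Definition standard : C 'I_n := MkC standard_pc.

Lemma presents_standard : presents standard [:: (t, enum 'I_n)].
Proof.
rewrite /presents /presents_in /= cats0; split=> [|u|k A x]; first exact: enum_uniq.
  by rewrite mem_enum [RHS]inE.
by rewrite inE => /eqP-> _ _ _; rewrite ffunE.
Qed.

Lemma standard_isomorphic (I : finType) (x : C I) (s : seq I) :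
  presents x [:: (t, s)] -> size s = n -> isomorphic standard x.
Proof.
move=> xP sn; have [] := xP; rewrite /= cats0 => us memS _.
have [s' s'E] : exists s' : n.-tuple I, s' = s :> seq I.
  by move/eqP: sn => sn; exists (Tuple sn).
have tE : map (tnth s') (enum 'I_n) = s by rewrite map_tnth_enum.
apply: (@presents_isomorphic _ _ _ _ (tnth s') [:: (t, enum 'I_n)]).
- apply: inj_card_bij.
    by apply/tuple_uniqP; rewrite s'E.
  rewrite card_ord -cardsT -(eq_card memS) (card_uniqP us) sn //.
- exact: presents_standard.
by rewrite /= /map_strand /= tE.
Qed.

End Standard.

Section Characters.
Variable K : fieldType.
Implicit Types (z : functional_family K) (w : bool -> nat -> K).

Definition weight_of z (t : bool) (n : nat) : K := z 'I_n (standard t n).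

Lemma weight_of0 z t : is_character z -> weight_of z t 0 = 1.
Proof. by case=> z1 _ _; apply: z1; rewrite card_ord. Qed.

(** The first strand is split off by multiplicativity and, being alone on its vertices, is
    isomorphic to a standard path or cycle. *)
Lemma character_presents z (I : finType) (x : C I) (P : seq (bool * seq I)) :
  is_character z -> presents x P -> z I x = \prod_(k <- P) weight_of z k.1 (size k.2).
Proof.
move=> zc; have [z1 zM zI] := zc.
have [n] := ubnP (size P).
elim: n I x P => // n IHn I x [_ xP|[t s] P].
  rewrite big_nil z1 //; apply: eq_card0 => u.
  by have [k] := presents_mem u xP.
rewrite ltnS => Pn xP; have [+ memP gP] := xP; rewrite /= cat_uniq => /and3P[us /hasPn disj uP].
pose S := [set u in s].
have [|Q QE Qx] := @presents_induced _ S x [:: (t, s)].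
  rewrite /presents_in /= cats0; split=> // [u|k A u]; first by rewrite inE.
  by rewrite inE => /eqP-> _ uA ut; apply: (gP _ _ u); rewrite ?mem_head ?subsetT.
have [|R RE Rx] := @presents_induced _ (~: S) x P.
  split=> // [u|k A u kP _ uA uk].
    have := memP u; rewrite !inE mem_cat; have := disj u.
    by case: (u \in s); case: (u \in flatten _) => //= /(_ isT).
  by apply: (gP _ _ u); rewrite ?inE ?kP ?orbT ?subsetT.
pose y := disjoint_union (induced x S) (induced x (~: S)).
have yP : presents y (map (map_strand id) ((t, s) :: P)).
  have -> : map (map_strand id) ((t, s) :: P) = map (map_strand val) Q ++ map (map_strand val) R.
    by rewrite QE RE -[RHS]map_id; apply: eq_map => -[b r]; rewrite /map_strand /= map_id.
  exact: presents_union.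
(* [x] and [y] have the same strands, so the identity is an isomorphism. *)
rewrite (zI _ _ x y); last by apply: presents_isomorphic xP yP; exists id.
have Rn : (size R < n)%N by rewrite -(size_map (map_strand val)) RE.
rewrite zM big_cons (IHn _ (induced x (~: S)) R Rn Rx) -RE big_map; congr (_ * _); last first.
  by apply: eq_bigr => k _; rewrite size_map.
case: Q QE Qx {yP} => [|[t' s'] [|? ?]] //= [-> <-] Qx; rewrite size_map.
by apply/esym/zI; apply: (@standard_isomorphic _ _ _ (induced x S) s').
Qed.

Lemma weight_family_character w : (forall t, w t 0%N = 1) ->
  is_character (weight_family w).
Proof.
move=> w0; split=> [I x I0|I S x y|I J x y xy].
- have noI u : u \in I -> False by rewrite (card0_eq I0).
  rewrite (@weight_familyE _ _ _ _ [::]) ?big_nil //; split=> // u; by case: (noI u).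
- have [P xP] := presents_exists (graphP x); have [Q yQ] := presents_exists (graphP y).
  rewrite (weight_familyE w0 xP) (weight_familyE w0 yQ).
  rewrite (weight_familyE (x := disjoint_union x y) w0 (presents_union xP yQ)) big_cat !big_map.
  by congr (_ * _); apply: eq_bigr => k _; rewrite size_map.
have [P xP] := presents_exists (graphP x); have [f yP] := isomorphic_presents xy xP.
rewrite (weight_familyE w0 xP) (weight_familyE w0 yP) big_map.
by apply: eq_bigr => k _; rewrite size_map.
Qed.

Lemma weight_of_family w : (forall t, w t 0%N = 1) -> weight_of (weight_family w) = w.
Proof.
move=> w0; apply: functional_extensionality => t; apply: functional_extensionality => n.
rewrite /weight_of (weight_familyE w0 (presents_standard t n)) big_seq1 /=.
by rewrite size_enum_ord.
Qed.

Lemma character_weight_family z : is_character z -> z = weight_family (weight_of z).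
Proof.
move=> zc; apply: functional_extensionality_dep => I.
apply: functional_extensionality => x; have [P xP] := presents_exists (graphP x).
rewrite (character_presents zc xP) (weight_familyE _ xP) // => t.
exact: weight_of0.
Qed.

End Characters.

(** * Restriction, deletion and convolution *)

Lemma gaps_cat (K : fieldType) (a : nat -> K) i m1 m2 :
  gaps a i (m1 ++ true :: m2) = gaps a i m1 * gaps a 0 m2.
Proof. by elim: m1 i => [|[] m1 IHm] i //=; rewrite IHm // mulrA. Qed.

Lemma gaps_nseq (K : fieldType) (a : nat -> K) i j : gaps a i (nseq j false) = a (i + j)%N.
Proof. by elim: j i => [|j IHj] i /=; rewrite ?addn0 // IHj addSnnS. Qed.

(** Runs can be read in either direction; a prolongation of the first run becomes entries [false] at
    the other end. *)
Lemma gaps_rev (K : fieldType) (a : nat -> K) i j m :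
  gaps a i (rev m ++ nseq j false) = gaps a j (m ++ nseq i false).
Proof.
elim: m i j => [|[] m IHm] i j /=; first by rewrite !gaps_nseq addnC.
  rewrite rev_cons cat_rcons gaps_cat gaps_nseq add0n mulrC; congr (_ * _).
  by rewrite -IHm cats0.
by rewrite rev_cons cat_rcons -IHm.
Qed.

Section Cut.
Variables (I : finType) (S : {set I}).
Implicit Types (s r : seq I) (g : mgraph I) (A : {set I}).

(** Empty runs are kept, so that k entries in S always leave k + 1 runs, matching [gaps]. *)
Fixpoint runs s : seq (seq I) :=
  if s is x :: s' then
    if x \in S then [::] :: runs s'
    else (x :: head [::] (runs s')) :: behead (runs s')
  else [:: [::]].

Lemma runsE s : runs s = head [::] (runs s) :: behead (runs s).
Proof. by case: s => //= x s; case: ifP. Qed.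

Lemma flatten_runs s : flatten (runs s) = filter [predC S] s.
Proof. by elim: s => //= x s <-; case: ifP => //= _; rewrite [in RHS]runsE. Qed.

Lemma gaps_runs (K : fieldType) (a : nat -> K) i s :
  a (i + size (head [::] (runs s)))%N * \prod_(r <- behead (runs s)) a (size r)
  = gaps a i (map (mem S) s).
Proof.
elim: s i => [|x s IHs] i /=; first by rewrite addn0 big_nil mulr1.
case: ifP => _ /=; last by rewrite addnS -IHs addSn.
by rewrite addn0 -IHs [in LHS]runsE big_cons.
Qed.

Lemma count_runs A s : A \subset ~: S ->
  count_mem A (path_edges s) = (\sum_(r <- runs s) count_mem A (path_edges r))%N.
Proof.
move=> AS; have notA x y : (x \in S) || (y \in S) -> ([set x; y] == A) = false.
  move=> xyS; apply/eqP=> xyA; move: AS; rewrite -xyA => /subsetP AS.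
  by have := AS x (set21 x y); have := AS y (set22 x y); rewrite !inE;
    case/orP: xyS => ->.
elim: s => [|x [|y s] IHs]; rewrite ?path_edges_cons2.
- by rewrite big_seq1.
- by rewrite /=; case: ifP; rewrite !big_cons big_nil.
have -> : runs [:: x, y & s] = if x \in S then [::] :: runs (y :: s)
    else (x :: head [::] (runs (y :: s))) :: behead (runs (y :: s)) by [].
rewrite /= in IHs *; case: ifPn => [xS|xS].
  by rewrite notA ?xS // IHs big_cons.
case: ifPn IHs => [yS|yS] IHs; first by rewrite notA ?yS ?orbT // IHs !big_cons.
by rewrite IHs !big_cons path_edges_cons2 /= addnA.
Qed.

Lemma count_run A x r s : A \subset ~: S -> uniq (filter [predC S] s) ->
    r \in runs s -> x \in A -> x \in r ->
  count_mem A (path_edges s) = count_mem A (path_edges r).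
Proof.
move=> AS; rewrite -flatten_runs (count_runs _ AS) => + + xA xr.
elim: (runs s) => //= r' R IHR; rewrite cat_uniq inE big_cons => /and3P[_ /hasPn disj uR].
have out s' : x \notin s' -> count_mem A (path_edges s') = 0%N.
  by move=> xs'; apply/count_memPn; apply: contra xs' => /path_edges_mem; apply.
case/predU1P=> [rE|rR].
  rewrite -rE big1_seq ?addn0 // => r2 /andP[_ r2R]; apply: out; apply/negP=> xr2.
  have /disj/negP[] : x \in flatten R by apply/flattenP; exists r2.
  by rewrite -rE.
rewrite IHR // out //; apply: disj; apply/flattenP; by exists r.
Qed.

(** A cycle that meets S is opened at its first vertex in S, which is dropped, and is then split
    like a path; a cycle that avoids S survives. *)
Definition cut (k : bool * seq I) : seq (bool * seq I) :=
  if k.1 && ~~ has (mem S) k.2 then [:: k]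
  else map (pair false) (runs (if k.1 then
    drop (find (mem S) k.2).+1 k.2 ++ take (find (mem S) k.2) k.2 else k.2)).

Lemma flatten_cut k : perm_eq (flatten (unzip2 (cut k))) (filter [predC S] k.2).
Proof.
have unz R : unzip2 (map (pair false) R) = R :> seq (seq I).
  by rewrite /unzip2 -map_comp map_id.
case: k => [[] s]; rewrite /cut /= ?unz ?flatten_runs //.
case: ifPn => [nS|]; first by rewrite /= cats0 (all_filterP _) // all_predC.
rewrite negbK => hS; rewrite unz flatten_runs.
case/split_find: hS => z s1 s2 zS _.
by rewrite filter_cat cat_rcons !filter_cat /= (zS : z \in S) /= perm_catC.
Qed.

Lemma prod_cut (K : fieldType) (w : bool -> nat -> K) k :
  \prod_(k' <- cut k) w k'.1 (size k'.2)
  = if k.1 then cyclic_gaps (w false) (w true) 0 (map (mem S) k.2)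
    else gaps (w false) 0 (map (mem S) k.2).
Proof.
have path s : \prod_(k' <- map (pair false) (runs s)) w k'.1 (size k'.2)
    = gaps (w false) 0 (map (mem S) s).
  by rewrite big_map -gaps_runs add0n [in LHS]runsE big_cons.
have noS s : ~~ has (mem S) s -> map (mem S) s = nseq (size s) false.
  by elim: s => //= x s IHs /norP[/negPf-> /IHs->].
have cyc i j m : cyclic_gaps (w false) (w true) i (nseq j false ++ m)
    = cyclic_gaps (w false) (w true) (i + j) m.
  by elim: j i => [|j IHj] i /=; rewrite ?addn0 // IHj addSnnS.
case: k => [[] s]; rewrite /cut //=; case: ifPn => [nS|].
  by rewrite big_seq1 /= noS // -[nseq _ _]cats0 cyc add0n.
rewrite negbK path => hS; case/split_find: hS => z s1 s2 zS nS.
rewrite cat_rcons !map_cat (noS s1) // cyc add0n /= (zS : z \in S).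
(* [cut] puts the initial run at the end, whereas [cyclic_gaps] reverses the rest and prolongs its
   first run. *)
by rewrite -[rev _]cats0 (gaps_rev _ _ 0).
Qed.

Lemma cut_local g k k' A x :
    uniq k.2 -> local g k.2 (kind_edges k) -> k' \in cut k ->
    A \subset ~: S -> x \in A -> x \in k'.2 ->
  g A = count_mem A (kind_edges k').
Proof.
move=> uk gk k'k AS xA xk'.
have xk : x \in k.2.
  have : x \in flatten (unzip2 (cut k)) by apply/mem_flatten_strands; exists k'.
  by rewrite (perm_mem (flatten_cut k)) mem_filter => /andP[].
rewrite (gk A x xA xk); move: k'k; rewrite /cut; case: ifP => [_|].
  by rewrite inE => /eqP->.
case: k uk xk {gk} => -[] s /= us xs; last first.
  by move=> _ /mapP[r rs k'E]; rewrite k'E in xk' *; apply: count_run rs xA xk';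
    rewrite ?filter_uniq.
move/negbFE=> hS /mapP[r + k'E]; rewrite k'E in xk' *; rewrite /kind_edges /=.
case/split_find: hS us {xs} => z s1 s2 zS _; rewrite cat_rcons => us rs.
have cz l : count_mem A (path_edges (z :: l)) = count_mem A (path_edges l).
  case: l => // y l; rewrite path_edges_cons2 /=; case: eqP => // zA.
  by have := subsetP AS z; rewrite -zA set21 inE (zS : z \in S) => /(_ isT).
have czr l : count_mem A (path_edges (rcons l z)) = count_mem A (path_edges l).
  by rewrite -count_rev -path_edges_rev rev_rcons cz path_edges_rev count_rev.
rewrite -(permP (perm_cycle_edges_rot (size s1) _)) rot_size_cat cat_cons.
rewrite cycle_edges_cons -rcons_cons czr cz; apply: count_run rs xA xk' => //.
rewrite filter_uniq //; move: us; rewrite -cat_rcons cat_uniq rcons_uniq.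
rewrite uniq_catC cat_uniq => /and3P[/andP[_ us1] /hasPn d us2].
rewrite us1 us2 andbT; apply/hasPn=> y ys2; apply: contra (d y ys2).
by rewrite mem_rcons inE => ->; rewrite orbT.
Qed.

Lemma presents_cut g P : presents g P -> presents_in (~: S) g (flatten (map cut P)).
Proof.
move=> gP; have [uP memP _] := gP.
have fl : perm_eq (flatten (unzip2 (flatten (map cut P))))
    (filter [predC S] (flatten (unzip2 P))).
  elim: (P) => //= k Q IHQ.
  by rewrite /unzip2 map_cat flatten_cat filter_cat perm_cat ?flatten_cut.
split=> [|x|k A x /flatten_mapP[k0 k0P kk0] AS xA xk].
- by rewrite (perm_uniq fl) filter_uniq.
- by rewrite (perm_mem fl) mem_filter memP !inE andbT.
have [uk0 _ gk0] := presents_strand gP k0P.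
exact: cut_local uk0 gk0 kk0 AS xA xk.
Qed.

(** Threads are counted by [count_threads] along a path; a cycle is first unrolled into a path from
    [val u] back to itself. *)
Lemma restrict_local g k (s' : seq (sub S)) (A : {set sub S}) u :
    strand g k.2 (kind_edges k) -> map val s' = filter (mem S) k.2 ->
    u \in A -> u \in s' ->
  restrict_graph g S A = count_mem A (kind_edges (k.1, s')).
Proof.
case: k => [[] s] /= gs s'E uA us'; rewrite ffunE.
- have us : val u \in s.
    by move: (map_f val us'); rewrite s'E mem_filter => /andP[].
  have uS : val u \in S by apply: valP.
  case: gs => uniqs _ gL; case/rot_to: us (us) => i q rE us.
  have gs' : strand g (val u :: q) (cycle_edges (val u :: q)).
    split; [by rewrite -rE rot_uniq | by right|] => B y yB.
    rewrite -rE mem_rot => ys; rewrite (gL B y yB ys).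
    by apply/esym/permP/perm_cycle_edges_rot.
  have [Es [uE tE full]] := strand_full gs'; have [/andP[uq uniqq] _ _] := gs'.
  have qu : val u :: rcons q (val u) =i val u :: q.
    by move=> y; rewrite !inE mem_rcons inE; case: eqP.
  rewrite (@count_threads _ g S Es [::] (val u) (rcons q (val u))) //; first last.
  + by exists u => //=; rewrite mem_head.
  + by move=> e y ye; rewrite qu; apply: full.
  + by rewrite /= uS /= filter_rcons /= uS /= filter_uniq.
  + by rewrite tE cycle_edges_cons.
  rewrite -(count_mem_imset _ _ val_inj) /kind_edges /= -cycle_edges_map s'E.
  rewrite filter_rcons /= uS -cycle_edges_cons.
  (* Filtering a rotated list rotates the filtered one, which leaves the cycle edges the same up to
     order. *)
  have -> : val u :: filter (mem S) q = rot (size (filter (mem S) (take i s))) (filter (mem S) s).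
    rewrite -[in filter (mem S) s](cat_take_drop i s) filter_cat rot_size_cat.
    by rewrite -filter_cat -/(rot i s) rE /= uS.
  exact/permP/perm_cycle_edges_rot.
have [Es [uE tE full]] := strand_full gs; case: gs => uniqs _ _.
have us : val u \in filter (mem S) s by rewrite -s'E map_f.
have hS : has (mem S) s by rewrite has_filter; case: filter us.
rewrite -(count_mem_imset _ _ val_inj) /kind_edges /= -path_edges_map s'E.
case/split_find: hS tE full uniqs us {s'E} => a pre q aS npre.
rewrite cat_rcons => tE full uniqs us.
rewrite (@count_threads _ g S Es pre a q) //; first last.
- by exists u => //; move: us; rewrite mem_filter => /andP[].
- by rewrite filter_uniq.
- by rewrite all_predC.
by rewrite filter_cat /= (aS : a \in S); move: npre; rewrite has_filter negbK => /eqP->.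
Qed.

Lemma presents_restrict g P : presents g P ->
  exists2 Q, map (map_strand val) Q = [seq (k.1, filter (mem S) k.2) | k <- P]
    & presents (restrict_graph g S) Q.
Proof.
move=> gP; have [uP memP _] := gP.
have fl : flatten (unzip2 [seq (k.1, filter (mem S) k.2) | k <- P])
    = filter (mem S) (flatten (unzip2 P)).
  by elim: (P) => //= k Q ->; rewrite filter_cat.
have [|Q QE] := @lift_strands _ S [seq (k.1, filter (mem S) k.2) | k <- P].
  by move=> x; rewrite fl mem_filter => /andP[].
exists Q => //; rewrite -QE flatten_map_strand in fl; split.
- by rewrite -(map_inj_uniq val_inj) fl filter_uniq.
- by move=> u; rewrite -(mem_map val_inj) fl mem_filter memP !inE andbT; exact: (valP u).
move=> k A u kQ _ uA uk.
have: map_strand val k \in [seq (k.1, filter (mem S) k.2) | k <- P] by rewrite -QE map_f.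
case/mapP=> k0 k0P [kE1 kE2].
rewrite (restrict_local (presents_strand gP k0P) kE2 uA uk) -kE1.
by case: (k).
Qed.

End Cut.

(** For each S both factors become products over the strands of [x]; [sum_prod_strands] then
    exchanges sum and product. *)
Lemma convolution_weight (K : fieldType) (w w' : bool -> nat -> K) :
    (forall t, w t 0%N = 1) -> (forall t, w' t 0%N = 1) ->
  convolution (weight_family w) (weight_family w') = weight_family (conv_weight w w').
Proof.
move=> w0 w0'; apply: functional_extensionality_dep => I.
apply: functional_extensionality => x; have [P xP] := presents_exists (graphP x).
have conv0 t : conv_weight w w' t 0 = 1 by case: t; rewrite /conv_weight /= w0 w0' mulr1.
have [uP memP _] := xP.
rewrite (weight_familyE conv0 xP) /convolution.
rewrite -(sum_prod_strands (fun t m => w t (count id m) *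
  if t then cyclic_gaps (w' false) (w' true) 0 m else gaps (w' false) 0 m) uP);
  last by move=> y; rewrite memP inE.
apply: eq_bigr => S _; have [Q QE Qx] := presents_restrict S xP.
have [R RE Rx] := presents_induced (presents_cut S xP).
rewrite (weight_familyE (x := restriction x S) w0 Qx).
rewrite (weight_familyE (x := induced x (~: S)) w0' Rx) big_split; congr (_ * _).
  transitivity (\prod_(k <- map (map_strand val) Q) w k.1 (size k.2)).
    by rewrite big_map; apply: eq_bigr => k _; rewrite size_map.
  rewrite QE big_map; apply: eq_bigr => k _.
  by rewrite /= count_map size_filter; congr (w _ _); apply: eq_count.
transitivity (\prod_(k <- map (map_strand val) R) w' k.1 (size k.2)).
  by rewrite big_map; apply: eq_bigr => k _; rewrite size_map.
rewrite RE big_flatten big_map; apply: eq_bigr => k _; exact: prod_cut.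
Qed.

Theorem theorem4p4 (K : fieldType) (charK : ([pchar K] =i pred0)%R) :
  [/\ is_group (@is_character K) (@convolution K),
      is_group (@is_series_pair K) (@pair_mul K)
    & exists phi : functional_family K -> power_series K * power_series K,
        is_group_iso (@is_character K) (@convolution K)
                     (@is_series_pair K) (@pair_mul K) phi].
Proof.
pose phi z := series_of_weight (@weight_of K z).
have convE z z' : is_character z -> is_character z' ->
    convolution z z' = weight_family (conv_weight (weight_of z) (weight_of z')).
  move=> zc zc'; rewrite {1}(character_weight_family zc) {1}(character_weight_family zc').
  by apply: convolution_weight => t; apply: weight_of0.
have conv0 z z' : is_character z -> is_character z' ->
    forall t, conv_weight (weight_of z) (weight_of z') t 0%N = 1.
  by move=> zc zc' t; rewrite /conv_weight /=; case: t; rewrite !weight_of0 // mulr1.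
have nz n : n.+1%:R != 0 :> K by move/pcharf0P: charK => ->.
have phi_iso : is_group_iso (@is_character K) (@convolution K)
                     (@is_series_pair K) (@pair_mul K) phi.
  split.
  - by move=> z zc; split; rewrite /= ?weight_of0 // invr0 mulr0.
  - move=> z z' zc zc' [E1 E2].
    rewrite (character_weight_family zc) (character_weight_family zc'); congr weight_family.
    apply: functional_extensionality => t; apply: functional_extensionality => n.
    case: t; last exact: (congr1 (fun f => f n.+1) E1).
    (* The constant term of h carries no information, but the value at 0 vertices is always 1. *)
    case: n => [|n]; first by rewrite !weight_of0.
    by have /(congr1 (fun f => f n.+1)) /(divIf (nz n)) := E2.
  - move=> [g h] [/= g0 g1 h0].
    (* The preimage: multiplication by n undoes the division, and the cycle value at 0 is set to
       1. *)
    pose w t n := if t then (if n is 0%N then 1 else h n * n%:R) else g n.+1.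
    have w0 t : w t 0%N = 1 by case: t.
    exists (weight_family w); first exact: weight_family_character.
    rewrite /phi weight_of_family //; congr pair; apply: functional_extensionality.
      by case=> [|n] /=; rewrite ?g0.
    by case=> [|n] /=; rewrite ?invr0 ?mulr0 ?h0 // mulfK.
  move=> z z' zc zc'; rewrite convE // /phi weight_of_family; last exact: conv0.
  by apply: series_of_conv_weight => //; apply: weight_of0.
split; [|exact: series_pair_group|by exists phi].
apply: is_group_iso_group (series_pair_group K) phi_iso => z z' zc zc'.
by rewrite convE //; apply: weight_family_character; apply: conv0.
Qed.
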